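(* Let $\alpha\in(0,1/2)$ and let $f:[0,\infty)\to\mathbb{R}$ be strictly monotone with $f(0)=0$. There exists a constant $\epsilon>0$ such that for all sufficiently large $n$ and all $k\le\alpha n$, any randomized streaming algorithm which outputs (with constant probability) a $(1+\epsilon)$-approximation to $\sum_{i=1}^k f(\sigma_i(A))$ of an $n\times n$ matrix $A$ given as a stream of entry updates requires $\Omega(n^{1+\Theta(1/\ln\alpha)})$ bits of space. This holds even when $A$ is promised to have $O(n)$ non-zero entries.
   Context: Streaming model: an underlying $n\times n$ matrix $A$ (initially zero) receives a sequence of updates $(i,j,\delta)$ meaning $A_{i,j}\leftarrow A_{i,j}+\delta$; the algorithm outputs its estimate at the end. $\sigma_1(A)\ge\sigma_2(A)\ge\cdots\ge\sigma_n(A)$ are the singular values of $A$. A $(1+\epsilon)$-approximation to $Q$ is a value in $[(1-\epsilon)Q,(1+\epsilon)Q]$. The constants hidden in $\Omega$ and $\Theta$ may depend on $\alpha$. *)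

(* Defs.v *)
From HB Require Import structures.
From mathcomp Require Import all_boot all_order all_algebra.
From mathcomp Require Import polyrcf.
From mathcomp Require Import all_classical all_reals all_analysis.
Set Implicit Arguments.
Unset Strict Implicit.
Unset Printing Implicit Defensive.
Import Order.TTheory GRing.Theory Num.Theory.
Local Open Scope ring_scope.

(* [rootsR] lists the distinct real roots of a polynomial in increasing order;
   [mup] restores the multiplicities. *)
Definition real_roots (R : realType) (p : {poly R}) : seq R :=
  flatten [seq nseq (mup x p) x | x <- rootsR p].

Definition singular_values (R : realType) (n : nat) (A : 'M[R]_n) : seq R :=
  rev [seq Num.sqrt x | x <- real_roots (char_poly (A^T *m A))].

(* Singular values are indexed from 0 here: [nth 0 (singular_values A) i] is
   the (i+1)-st largest one. *)
Definition top_spectral_sum (R : realType) (f : R -> R) (n k : nat)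
    (A : 'M[R]_n) : R :=
  \sum_(i < k) f (nth 0 (singular_values A) i).

Definition strictly_monotone_nneg (R : realType) (f : R -> R) : Prop :=
  (forall x y : R, 0 <= x -> x < y -> f x < f y) \/
  (forall x y : R, 0 <= x -> x < y -> f y < f x).

(* [y] lies between [(1 - eps) * q] and [(1 + eps) * q]; the absolute value on
   the right orients the interval correctly when [q < 0], which happens for
   decreasing [f]. *)
Definition approximates (R : realType) (eps y q : R) : Prop :=
  `|y - q| <= eps * `|q|.

Definition update (R : realType) (n : nat) : Type := ('I_n * 'I_n * R)%type.

Definition stream_matrix (R : realType) (n : nat) (s : seq (update R n)) :
    'M[R]_n :=
  \sum_(u <- s) u.2 *: delta_mx u.1.1 u.1.2.

Definition nnz (R : realType) (n : nat) (A : 'M[R]_n) : nat :=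
  #|[set ij : 'I_n * 'I_n | A ij.1 ij.2 != 0%R]|.

(* At most [n ^ d] updates, each an integer of magnitude at most [n ^ d].  A
   bound of this kind makes space in bits meaningful: over unbounded streams of
   real updates, [f] may take values on infinitely many scales, which no finite
   memory can tell apart.  For [2 <= d] every matrix with integer entries in
   range is reachable. *)
Definition poly_bounded (R : realType) (n d : nat) (s : seq (update R n)) :
    Prop :=
  (size s <= n ^ d)%N /\
  (forall u, u \in s -> u.2 \is a Num.int /\ `|u.2| <= (n ^ d)%:R).

(* The random tape is drawn once, is read-only, and is not charged to the
   space.  Transitions also see the number of updates read so far (again free of
   charge), so that fresh coins may be used at each update.  Only the [bits]
   bits carried from one update to the next are counted. *)
Record streaming_algorithm (R : realType) (n : nat) := StreamingAlgorithm {
  bits : nat;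
  disp : measure_display;
  tape : measurableType disp;
  law : probability tape R;
  start : tape -> bits.-tuple bool;
  step : tape -> nat -> bits.-tuple bool -> update R n -> bits.-tuple bool;
  estimate : tape -> nat -> bits.-tuple bool -> R
}.

Definition memory_after (R : realType) (n : nat)
    (alg : streaming_algorithm R n) (w : tape alg) (s : seq (update R n)) :
    (bits alg).-tuple bool :=
  (foldl (fun tm u => (tm.1.+1, step w tm.1 tm.2 u)) (0%N, start w) s).2.

Definition output (R : realType) (n : nat)
    (alg : streaming_algorithm R n) (w : tape alg) (s : seq (update R n)) : R :=
  estimate w (size s) (memory_after w s).

(* For each admissible stream separately (the stream is fixed before the
   tape is drawn), the output is correct with probability at least [p]. *)
Definition approximates_on (R : realType) (n : nat)
    (alg : streaming_algorithm R n) (admissible : seq (update R n) -> Prop)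
    (Q : 'M[R]_n -> R) (eps p : R) : Prop :=
  forall s, admissible s ->
    let good := [set w : tape alg |
                  approximates eps (output w s) (Q (stream_matrix s))]%classic in
    measurable good /\ (p%:E <= law alg good)%E.

Definition requires_space (R : realType) (n : nat)
    (admissible : seq (update R n) -> Prop) (Q : 'M[R]_n -> R) (eps p b : R) :
    Prop :=
  forall alg : streaming_algorithm R n,
    approximates_on alg admissible Q eps p -> b <= (bits alg)%:R.

(* Main.v *)
Require Import Defs.
From mathcomp Require Import all_boot all_order all_algebra.
From mathcomp Require Import fingroup perm.
From mathcomp Require Import polyrcf.
From mathcomp Require Import zify ring lra.
Set Implicit Arguments.
Unset Strict Implicit.
Unset Printing Implicit Defensive.
Import Order.TTheory GRing.Theory Num.Theory.
Local Open Scope ring_scope.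

(* Hidden t-hypermatching, with t the largest integer such that t alpha < 1.  Let x
   be n signs on the diagonal of A and let each hyperedge of a random partial
   t-hypermatching, with m = floor(alpha n) hyperedges, be a cyclic shift of its t
   indices carrying one sign w_j.  Such a block is, up to changes of sign, the
   identity plus a cycle: its largest singular value is 2 when w_j is the parity of
   x on the hyperedge, and at most a constant tau(t) < 2 when w_j is the opposite
   sign.  So for every k <= m the sum over the top k singular values is k f(2) if w
   is the vector of parities, and at most k |f(tau)| in absolute value if w is its
   complement.

   The stream presents x first, so the memory at half time is a one-way message
   about x.  Conditioned on that message x is uniform in a set of log-density -b.
   By Plancherel, the distance between the laws of the parity vector and of its
   complement is governed by the squared Fourier coefficients of that set at unions
   of l hyperedges, i.e. on average over the hypermatching by
   C(m, l) / C(n, l t) times its Fourier weight at level l t.  Hypercontractivity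
   bounds the latter, and the sum over l is small while b = o(n^(1 - 1/t)); since
   t alpha < 1, a positive fraction of the indices is unmatched, which makes the
   terms with l of order b or more negligible. *)

(** * Power means *)

(** Lagrange's identity: twice the difference of the two sides is the double sum of the squares
    [(a i * b j - a j * b i) ^+ 2]. *)
Lemma cauchy_schwarz (R : realDomainType) (I : finType) (a b : I -> R) :
  (\sum_i a i * b i) ^+ 2 <= (\sum_i a i ^+ 2) * (\sum_i b i ^+ 2).
Proof.
have e1 : (\sum_i a i * b i) ^+ 2 = \sum_i \sum_j (a i * b i) * (a j * b j).
  by rewrite expr2 mulr_suml; apply: eq_bigr => i _; rewrite mulr_sumr.
have e2 : (\sum_i a i ^+ 2) * (\sum_i b i ^+ 2) =
    \sum_i \sum_j a i ^+ 2 * b j ^+ 2.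
  by rewrite mulr_suml; apply: eq_bigr => i _; rewrite mulr_sumr.
have e3 : (\sum_i a i ^+ 2) * (\sum_i b i ^+ 2) =
    \sum_i \sum_j a j ^+ 2 * b i ^+ 2.
  by rewrite e2 exchange_big.
have : 0 <= \sum_i \sum_j (a i * b j - a j * b i) ^+ 2.
  by apply: sumr_ge0 => i _; apply: sumr_ge0 => j _; exact: sqr_ge0.
have -> : \sum_i \sum_j (a i * b j - a j * b i) ^+ 2 =
    (\sum_i a i ^+ 2) * (\sum_i b i ^+ 2) + (\sum_i a i ^+ 2) * (\sum_i b i ^+ 2)
    - (\sum_i a i * b i) ^+ 2 *+ 2.
  rewrite {1}e2 e3 e1 -big_split -sumrMnl -sumrB; apply: eq_bigr => i _.
  by rewrite -big_split -sumrMnl -sumrB; apply: eq_bigr => j _ /=; ring.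
lra.
Qed.

Lemma subr_expr_ge0 (R : realDomainType) (u v : R) q :
  0 <= u -> 0 <= v -> 0 <= (u - v) * (u ^+ q - v ^+ q).
Proof.
move=> u0 v0; case: (leP u v) => uv.
  by rewrite mulr_le0 // subr_le0 // lerXn2r.
by rewrite mulr_ge0 // subr_ge0 ?lerXn2r // ltW.
Qed.

(** Induction on [q]. The step is Chebyshev's sum inequality for the similarly ordered families [u]
    and [u ^+ q.+1], obtained by summing [subr_expr_ge0] over all pairs. *)
Lemma power_mean (R : realDomainType) (I : finType) (A : {pred I}) (u : I -> R) q :
  (forall i, 0 <= u i) ->
  (\sum_(i in A) u i) ^+ q.+1 <= #|A|%:R ^+ q * \sum_(i in A) u i ^+ q.+1.
Proof.
move=> u0; elim: q => [|q IH].
  by rewrite expr0 mul1r expr1 (eq_bigr (fun i => u i)).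
rewrite exprS.
apply: (@le_trans _ _ ((\sum_(i in A) u i) *
    (#|A|%:R ^+ q * \sum_(i in A) u i ^+ q.+1))).
  by apply: ler_wpM2l => //; apply: sumr_ge0.
rewrite mulrCA (exprSr #|A|%:R q) -(mulrA _ #|A|%:R).
apply: ler_wpM2l; first by rewrite exprn_ge0.
set p := q.+1.
have : 0 <= \sum_(i in A) \sum_(j in A) (u i - u j) * (u i ^+ p - u j ^+ p).
  by apply: sumr_ge0 => i _; apply: sumr_ge0 => j _; exact: subr_expr_ge0.
have -> : \sum_(i in A) \sum_(j in A) (u i - u j) * (u i ^+ p - u j ^+ p) =
   (#|A|%:R * \sum_(i in A) u i ^+ p.+1) *+ 2
   - ((\sum_(i in A) u i) * (\sum_(i in A) u i ^+ p)) *+ 2.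
  transitivity (\sum_(i in A) ((#|A|%:R * u i ^+ p.+1 + \sum_(j in A) u j ^+ p.+1)
     - (u i * (\sum_(j in A) u j ^+ p) + u i ^+ p * \sum_(j in A) u j))).
    apply: eq_bigr => i _.
    rewrite [in RHS]mulr_natl -sumr_const 2!mulr_sumr -!big_split -sumrB.
    by apply: eq_bigr => j _ /=; rewrite !exprS; ring.
  rewrite sumrB !big_split /= -mulr_sumr -!mulr_suml sumr_const.
  by rewrite -(mulr_natl (\sum_(j in A) _)) /=; ring.
by rewrite -mulrnBl pmulrn_lge0 // subr_ge0.
Qed.

Lemma power_mean2 (R : realDomainType) (s r u v : R) q :
  0 <= s -> 0 <= r -> 0 <= u -> 0 <= v ->
  (s * u + r * v) ^+ q.+1 <= (s + r) ^+ q * (s * u ^+ q.+1 + r * v ^+ q.+1).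
Proof.
move=> s0 r0 u0 v0; elim: q => [|q IH]; first by rewrite expr0 mul1r.
rewrite exprS.
apply: (@le_trans _ _ ((s * u + r * v) *
    ((s + r) ^+ q * (s * u ^+ q.+1 + r * v ^+ q.+1)))).
  by apply: ler_wpM2l => //; rewrite addr_ge0 ?mulr_ge0.
rewrite mulrCA (exprSr (s + r) q) -(mulrA _ (s + r)).
apply: ler_wpM2l; first by rewrite exprn_ge0 ?addr_ge0.
have := mulr_ge0 (mulr_ge0 s0 r0) (subr_expr_ge0 q.+1 u0 v0).
by rewrite -subr_ge0 !(exprS _ q.+1) => h; apply: le_trans h _;
  rewrite le_eqVlt; apply/orP; left; apply/eqP; ring.
Qed.

(** Minkowski's inequality with all norms raised to the power [q], so that no roots occur: convexity
    with weights [s] and [r], applied to [U / s] and [V / r]. *)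
Lemma minkowski_bound (R : realFieldType) (X : finType) (U V : X -> R) (M s r : R) q :
  (0 < q)%N -> 0 <= s -> 0 <= r ->
  (forall x, 0 <= U x) -> (forall x, 0 <= V x) ->
  \sum_x U x ^+ q <= M * s ^+ q -> \sum_x V x ^+ q <= M * r ^+ q ->
  \sum_x (U x + V x) ^+ q <= M * (s + r) ^+ q.
Proof.
have zero (W : X -> R) p : (0 < p)%N -> (forall x, 0 <= W x) ->
    \sum_x W x ^+ p <= 0 -> forall x, W x = 0.
  move=> p0 W0 le x.
  have /eqP : \sum_x W x ^+ p = 0.
    by apply/le_anti; rewrite le sumr_ge0 // => ? _; rewrite exprn_ge0.
  rewrite psumr_eq0 => [|? _]; last by rewrite exprn_ge0.
  by move=> /allP/(_ x (mem_index_enum _)); rewrite implyTb expf_eq0 p0 => /eqP.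
move=> q0 s0 r0 U0 V0 hU hV.
(* A zero bound forces its function to vanish; this keeps [s] and [r] invertible below. *)
have [s_0|sn0] := eqVneq s 0.
  rewrite s_0 expr0n gtn_eqF // mulr0 in hU.
  rewrite s_0 add0r; under eq_bigr do rewrite (zero U q q0 U0 hU) add0r.
  exact: hV.
have [r_0|rn0] := eqVneq r 0.
  rewrite r_0 expr0n gtn_eqF // mulr0 in hV.
  rewrite r_0 addr0; under eq_bigr do rewrite (zero V q q0 V0 hV) addr0.
  exact: hU.
have sp : 0 < s by rewrite lt_def sn0.
have rp : 0 < r by rewrite lt_def rn0.
case: q q0 hU hV => // q _ hU hV.
apply: (@le_trans _ _ (\sum_x (s + r) ^+ q *
    (s * (U x / s) ^+ q.+1 + r * (V x / r) ^+ q.+1))).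
  apply: ler_sum => x _.
  have {1}-> : U x + V x = s * (U x / s) + r * (V x / r).
    by rewrite !(mulrC _ (_ / _)) !divfK.
  by apply: power_mean2 => //; rewrite divr_ge0.
rewrite -mulr_sumr big_split -!mulr_sumr /=.
under eq_bigr do rewrite expr_div_n.
rewrite -mulr_suml.
under [X in _ + _ * X]eq_bigr do rewrite expr_div_n.
rewrite -mulr_suml (exprSr (s + r)) (mulrCA M); apply: ler_wpM2l.
  by rewrite exprn_ge0 ?addr_ge0.
rewrite mulrDr (mulrC M s) (mulrC M r); apply: lerD; apply: ler_wpM2l => //.
  by rewrite ler_pdivrMr ?exprn_gt0.
by rewrite ler_pdivrMr ?exprn_gt0.
Qed.

(** The coefficientwise form of the two-point inequality. Comparing the growth of both sides from
    [j] to [j + 1] reduces to [2q - 2j - 1 <= (2j + 1)(2q - 1)]. *)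
Lemma bin_double_le q j :
  ('C(q.*2, j.*2) <= 'C(q, j) * (q.*2.-1) ^ j)%N.
Proof.
elim: j => [|j IH]; first by rewrite !bin0.
have [jq|qj] := ltnP j q; last first.
  by rewrite bin_small // ltn_double ltnS.
have e1 := mul_bin_left q.*2 j.*2.+1.
have e2 := mul_bin_left q.*2 j.*2.
have e3 := mul_bin_left q j.
rewrite -(@leq_pmul2l (j.*2.+2 * j.*2.+1)) ?muln_gt0 //.
rewrite doubleS mulnAC e1 -mulnA (mulnC 'C(_, _)) e2.
apply: (@leq_trans ((q.*2 - j.*2.+1) * ((q.*2 - j.*2) *
   ('C(q, j) * q.*2.-1 ^ j)))); first by rewrite !leq_mul2l IH !orbT.
rewrite expnS.
have -> : (j.*2.+2 * j.*2.+1 * ('C(q, j.+1) * (q.*2.-1 * q.*2.-1 ^ j)) =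
  2 * (j.+1 * 'C(q, j.+1)) * j.*2.+1 * (q.*2.-1 * q.*2.-1 ^ j))%N.
  have -> : (j.*2.+2 = 2 * j.+1)%N by lia.
  by move: (j.*2.+1) (q.*2.-1) (j.+1) ('C(q, _)) => u v w z; ring.
rewrite e3.
have -> : ((q.*2 - j.*2.+1) * ((q.*2 - j.*2) * ('C(q, j) * q.*2.-1 ^ j)) =
  (2 * (q - j) * 'C(q, j) * q.*2.-1 ^ j) * (q.*2 - j.*2.+1))%N.
  have -> : (q.*2 - j.*2 = 2 * (q - j))%N by lia.
  by move: (q.*2.-1 ^ j)%N (q.*2 - j.*2.+1)%N (q - j)%N 'C(q, j) => u v w z; ring.
have -> : (2 * ((q - j) * 'C(q, j)) * j.*2.+1 * (q.*2.-1 * q.*2.-1 ^ j) =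
  (2 * (q - j) * 'C(q, j) * q.*2.-1 ^ j) * (j.*2.+1 * q.*2.-1))%N.
  by move: (q.*2.-1) (q.*2.-1 ^ j)%N (j.*2.+1)%N (q - j)%N 'C(q, j) => u v w z p; ring.
by rewrite leq_mul2l; apply/orP; right; nia.
Qed.

Lemma sum_even (R : nzRingType) (F : nat -> R) q :
  \sum_(i < q.*2.+1) (1 + (-1) ^+ i) * F i = \sum_(j < q.+1) F j.*2 *+ 2.
Proof.
elim: q => [|q IH]; first by rewrite !big_ord1 expr0 mulrDl mul1r mulr2n.
have e : (-1) ^+ q.*2 = 1 :> R by rewrite -signr_odd odd_double.
rewrite doubleS 2!big_ord_recr IH /= [in RHS]big_ord_recr /= !exprS e.
by rewrite mulr1 mulrNN mulr1 subrr mul0r addr0 mulrDl mul1r -mulr2n.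
Qed.

(** Hypercontractivity on a single bit, between the exponents 2 and 2q. Odd powers of [g] cancel,
    and the even ones are compared term by term through [bin_double_le]. *)
Lemma two_point (R : realDomainType) (h g : R) q :
  (h + g) ^+ q.*2 + (h - g) ^+ q.*2 <=
    (h ^+ 2 + (q.*2.-1)%:R * g ^+ 2) ^+ q *+ 2.
Proof.
pose F i := h ^+ (q.*2 - i) * g ^+ i *+ 'C(q.*2, i).
have -> : (h + g) ^+ q.*2 + (h - g) ^+ q.*2 =
    \sum_(i < q.*2.+1) (1 + (-1) ^+ i) * F i.
  rewrite !exprDn -big_split; apply: eq_bigr => i _ /=.
 by rewrite (exprNn g) /F mulrnAr mulrDl mul1r mulrnDl (mulrCA (h ^+ _)).
rewrite sum_even exprDn -sumrMnl; apply: ler_sum => j _; rewrite lerMn2r /=.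
rewrite /F (exprMn _ (q.*2.-1%:R)) -!exprM -doubleB.
have e0 : 0 <= h ^+ (q - j).*2 * g ^+ j.*2.
  by rewrite mulr_ge0 // -mul2n exprM exprn_ge0 ?sqr_ge0.
have -> : h ^+ (2 * (q - j)) * (q.*2.-1%:R ^+ j * g ^+ (2 * j)) *+ 'C(q, j) =
    ('C(q, j) * q.*2.-1 ^ j)%:R * (h ^+ (q - j).*2 * g ^+ j.*2).
  by rewrite !mul2n -mulr_natl natrM natrX; ring.
by rewrite -[leLHS]mulr_natl; apply: ler_wpM2r => //; rewrite ler_nat bin_double_le.
Qed.

(** * Fourier analysis on the cube *)

Definition character (R : pzRingType) (I : finType) (T : {set I})
    (x : {ffun I -> bool}) : R := \prod_(i in T) (-1) ^+ x i.
Arguments character R {I} T x.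

Definition flip (I : finType) (i : I) (x : {ffun I -> bool}) : {ffun I -> bool} :=
  [ffun j => x j (+) (j == i)].

Lemma flipK (I : finType) (i : I) : involutive (flip i).
Proof. by move=> x; apply/ffunP => j; rewrite !ffunE -addbA addbb addbF. Qed.

Lemma character_flip (R : comPzRingType) (I : finType) (i : I) (T : {set I}) x :
  character R T (flip i x) = (if i \in T then -1 else 1) * character R T x.
Proof.
rewrite /character; case: ifP => iT.
  rewrite (bigD1 i) // (bigD1 i (P := mem T)) //= ffunE eqxx addbT.
  rewrite mulrA; congr (_ * _); first by case: (x i); rewrite /= ?expr1 expr0; ring.
  by apply: eq_bigr => j /andP[_ /negbTE ji]; rewrite ffunE ji addbF.
rewrite mul1r; apply: eq_bigr => j jT; rewrite ffunE.
by case: eqP => [ji|]; [rewrite ji iT in jT | rewrite addbF].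
Qed.

Lemma characterU1 (R : comPzRingType) (I : finType) (i : I) (T : {set I}) x :
  i \notin T -> character R (i |: T) x = (-1) ^+ x i * character R T x.
Proof. by move=> iT; rewrite /character big_setU1. Qed.

Lemma big_subsetU1 (V : nmodType) (I : finType) (i : I) (D : {set I})
    (F : {set I} -> V) : i \notin D ->
  \sum_(T : {set I} | T \subset i |: D) F T =
  \sum_(T : {set I} | T \subset D) (F T + F (i |: T)).
Proof.
move=> iD; rewrite big_split /= (bigID (fun T : {set I} => i \in T)) /= addrC.
congr (_ + _).
  by apply: eq_bigl => T; rewrite -subsetD1 setU1K.
rewrite (reindex_onto (fun T => i |: T) (fun T => T :\ i)) /=; last first.
  by move=> T /andP[_ iT]; rewrite setD1K.
apply: eq_bigl => T; rewrite setU11 andbT; apply/idP/idP.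
  move=> /andP[TD /eqP T1].
  have iT : i \notin T by rewrite -T1 setD11.
  apply/subsetP => j jT; have /setU1P[ji|//] := subsetP TD j (setU1r i jT).
  by move: iT; rewrite -ji jT.
move=> TD; have iT : i \notin T by apply/negP => /(subsetP TD); rewrite (negbTE iD).
by rewrite setUS // setU1K // eqxx.
Qed.

(** Bonami's inequality for the even exponent 2q; sums over the cube are not normalised, whence the
    factor [2 ^ #|I|]. Induction on [D]: splitting off a coordinate [i] writes the function as
    [h + (-1) ^+ x i * g], [two_point] handles that bit, and Minkowski's inequality recombines the
    bounds for [h] and [g]. *)
Lemma bonami (R : realFieldType) (I : finType) (q : nat) (D : {set I})
    (a : {set I} -> R) : (0 < q)%N ->
  \sum_x (\sum_(T : {set I} | T \subset D) a T * character R T x) ^+ q.*2 <=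
  (2 ^ #|I|)%:R *
  (\sum_(T : {set I} | T \subset D) (q.*2.-1)%:R ^+ #|T| * a T ^+ 2) ^+ q.
Proof.
move=> q0; move: {2}#|D| (erefl #|D|) => d; elim: d => [|d IH] in D a *.
  move=> /eqP; rewrite cards_eq0 => /eqP ->.
  have e (V : nmodType) (F : {set I} -> V) :
      \sum_(T : {set I} | T \subset set0) F T = F set0.
    by rewrite (eq_bigl (pred1 set0)) ?big_pred1_eq // => T; rewrite subset0.
  under eq_bigr do rewrite e /character big_set0 mulr1.
  rewrite e cards0 expr0 mul1r sumr_const card_ffun card_bool mulr_natl.
  by rewrite -exprM mul2n.
move=> dD; have /card_gt0P [i iD] : (0 < #|D|)%N by rewrite dD.
pose D' := D :\ i; have iD' : i \notin D' by rewrite setD11.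
have defD : D = i |: D' by rewrite setD1K.
have cD' : #|D'| = d by apply/eqP; rewrite -eqSS -dD (cardsD1 i D) iD.
have notin (T : {set I}) : T \subset D' -> i \notin T by move=> TD; apply/negP => /(subsetP TD); rewrite (negbTE iD').
pose h x := \sum_(T : {set I} | T \subset D') a T * character R T x.
pose g x := \sum_(T : {set I} | T \subset D') a (i |: T) * character R T x.
have hg x : \sum_(T : {set I} | T \subset D) a T * character R T x =
    h x + (-1) ^+ x i * g x.
  rewrite {1}defD big_subsetU1 // big_split /=; congr (_ + _).
  rewrite mulr_sumr; apply: eq_bigr => T TD; rewrite characterU1 ?notin //.
  by rewrite mulrCA.
have inv (T : {set I}) x : T \subset D' -> character R T (flip i x) = character R T x.
  by move=> TD; rewrite character_flip (negbTE (notin T TD)) mul1r.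
have h_inv x : h (flip i x) = h x by apply: eq_bigr => T TD; rewrite inv.
have g_inv x : g (flip i x) = g x by apply: eq_bigr => T TD; rewrite inv.
(* Pairing [x] with [flip i x] fixes [h] and [g] and changes only the sign in front of [g]. *)
have step : \sum_x (\sum_(T : {set I} | T \subset D) a T * character R T x) ^+ q.*2
    <= \sum_x (h x ^+ 2 + q.*2.-1%:R * g x ^+ 2) ^+ q.
  rewrite -(@ler_pMn2r _ 2) // -[leRHS]sumrMnl mulr2n.
  rewrite [X in X + _](reindex_inj (inv_inj (flipK i))) -big_split /=.
  apply: ler_sum => x _; rewrite !hg h_inv g_inv ffunE eqxx addbT.
  apply: le_trans _ (two_point (h x) (g x) q).
  by case: (x i); rewrite /= !expr0 !expr1 !mulN1r !mul1r // addrC.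
apply: le_trans step _.
rewrite defD big_subsetU1 // big_split /=.
apply: minkowski_bound => //.
- by apply: sumr_ge0 => T _; rewrite mulr_ge0 ?sqr_ge0 ?exprn_ge0.
- by apply: sumr_ge0 => T _; rewrite mulr_ge0 ?sqr_ge0 ?exprn_ge0.
- by move=> x; rewrite sqr_ge0.
- by move=> x; rewrite mulr_ge0 ?sqr_ge0.
- under [leLHS]eq_bigr do rewrite -exprM mul2n.
  exact: IH.
under [leLHS]eq_bigr do rewrite exprMn -exprM mul2n.
rewrite -mulr_sumr.
have -> : \sum_(T : {set I} | T \subset D') q.*2.-1%:R ^+ #|i |: T| * a (i |: T) ^+ 2 =
    q.*2.-1%:R * \sum_(T : {set I} | T \subset D')
      q.*2.-1%:R ^+ #|T| * a (i |: T) ^+ 2.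
  rewrite mulr_sumr; apply: eq_bigr => T TD.
  by rewrite cardsU1 notin // add1n exprS mulrA.
rewrite exprMn mulrCA; apply: ler_wpM2l; first by rewrite exprn_ge0.
exact: (IH D' (fun T => a (i |: T))).
Qed.

(** Duality: the level-[k] part [g] of the Fourier sum sums over [A] to the weight [B] itself.
    Hölder's inequality on [A] followed by [bonami] bounds [B ^+ q.*2] by a multiple of [B ^+ q].
    The hypothesis [b <= k * q] makes the density loss [2 ^ b] at most [2 ^ (k * q)], which the
    constant [4 * q] absorbs. *)
Lemma level_inequality (R : realFieldType) (I : finType)
    (A : {set {ffun I -> bool}}) k b q :
  (0 < q)%N -> (b <= k * q)%N -> (2 ^ #|I| <= #|A| * 2 ^ b)%N ->
  \sum_(T : {set I} | #|T| == k) (\sum_(x in A) character R T x) ^+ 2 <=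
  (4 * q)%:R ^+ k * #|A|%:R ^+ 2.
Proof.
move=> q0 bkq hA.
have A0 : (0 < #|A|)%N.
  rewrite lt0n; apply: contraTneq hA => ->; rewrite mul0n -ltnNge expn_gt0 //.
pose alpha T : R := \sum_(x in A) character R T x.
pose B := \sum_(T : {set I} | #|T| == k) alpha T ^+ 2.
pose a (T : {set I}) := if #|T| == k then alpha T else 0.
pose g x := \sum_(T : {set I}) a T * character R T x.
have B0 : 0 <= B by apply: sumr_ge0 => T _; rewrite sqr_ge0.
have gA : \sum_(x in A) g x = B.
  rewrite exchange_big /= /B [RHS]big_mkcond /=; apply: eq_bigr => T _.
  by rewrite -mulr_sumr /a; case: ifP; rewrite ?mul0r // expr2.
have sT (V : nmodType) (F : {set I} -> V) :
    \sum_(T : {set I} | T \subset [set: I]) F T = \sum_(T : {set I}) F T.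
  by apply: eq_bigl => T; rewrite subsetT.
have bon : \sum_x g x ^+ q.*2 <=
    (2 ^ #|I|)%:R * (\sum_(T : {set I}) q.*2.-1%:R ^+ #|T| * a T ^+ 2) ^+ q.
  have := bonami [set: I] a q0; rewrite sT; apply: le_trans.
  by apply: ler_sum => x _; rewrite sT.
have s_eq : \sum_(T : {set I}) q.*2.-1%:R ^+ #|T| * a T ^+ 2 = q.*2.-1%:R ^+ k * B.
  rewrite /B mulr_sumr [RHS]big_mkcond /=; apply: eq_bigr => T _.
  by rewrite /a; case: eqP => [->|] //; rewrite expr0n mulr0.
rewrite s_eq in bon.
have pm : B ^+ q.*2 <= #|A|%:R ^+ q.*2.-1 * \sum_(x in A) g x ^+ q.*2.
  rewrite -gA -mul2n !exprM.
  case: q q0 {bkq bon s_eq} => // q _.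
  apply: (@le_trans _ _ ((#|A|%:R * \sum_(x in A) g x ^+ 2) ^+ q.+1)).
    rewrite lerXn2r ?nnegrE ?sqr_ge0 ?mulr_ge0 ?sumr_ge0 // => [x _|].
      exact: sqr_ge0.
    have := cauchy_schwarz (fun x : {ffun I -> bool} => (x \in A)%:R)
      (fun x => (x \in A)%:R * g x).
    have -> : \sum_i (i \in A)%:R * ((i \in A)%:R * g i) = \sum_(x in A) g x.
      by rewrite [RHS]big_mkcond; apply: eq_bigr => x _; case: (x \in A); rewrite ?mul1r ?mul0r.
    have -> : \sum_i ((i \in A)%:R * g i) ^+ 2 = \sum_(x in A) g x ^+ 2.
      rewrite [RHS]big_mkcond; apply: eq_bigr => x _.
      by case: (x \in A); rewrite ?mul1r ?mul0r ?expr0n.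
    have -> // : \sum_i (i \in A)%:R ^+ 2 = #|A|%:R :> R.
    rewrite -sum1_card natr_sum [RHS]big_mkcond; apply: eq_bigr => x _.
    by case: (x \in A); rewrite ?expr1n ?expr0n.
  have := power_mean (mem A) q (fun x => sqr_ge0 (g x)).
  rewrite exprMn => /(ler_wpM2l (exprn_ge0 q.+1 (ler0n R #|A|))).
  move=> /le_trans; apply.
  rewrite mulrA -exprD; under eq_bigr do rewrite -exprM mul2n.
  under [X in _ <= _ * X]eq_bigr do rewrite mul2n.
  have -> // : (q.+1 + q = (2 * q.+1).-1)%N by lia.
(* Enlarging the sum of [g ^+ q.*2] from [A] to the cube brings in [2 ^ #|I|], at most
   [#|A| * 2 ^ b]. *)
have le1 : B ^+ q.*2 <= #|A|%:R ^+ q.*2 * ((2 ^ b)%:R * q.*2.-1%:R ^+ (k * q) * B ^+ q).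
  apply: (le_trans pm).
  have hq : q.*2 = q.*2.-1.+1 by lia.
  rewrite [in leRHS]hq exprS -!mulrA mulrCA; apply: ler_wpM2l.
    by rewrite exprn_ge0.
  apply: (@le_trans _ _ (\sum_x g x ^+ q.*2)).
    rewrite [leLHS]big_mkcond; apply: ler_sum => x _; case: ifP => // _.
    by rewrite -mul2n exprM exprn_ge0 ?sqr_ge0.
  apply: (le_trans bon); rewrite exprMn -exprM !mulrA -natrM.
  apply: ler_wpM2r; first by rewrite exprn_ge0.
  apply: ler_wpM2r; first by rewrite exprn_ge0.
  by rewrite ler_nat.
have [B_0|Bn0] := eqVneq B 0.
  by rewrite -/B B_0 mulr_ge0 ?exprn_ge0.
have Bp : 0 < B by rewrite lt_def Bn0.
have : (B / #|A|%:R ^+ 2) ^+ q <= ((4 * q)%:R ^+ k) ^+ q.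
  rewrite expr_div_n -(exprM _ 2) mul2n ler_pdivrMr ?exprn_gt0 ?ltr0n //.
  rewrite -(@ler_pM2r _ (B ^+ q)) ?exprn_gt0 // -exprD addnn.
  apply: (le_trans le1); rewrite mulrA (mulrC (#|A|%:R ^+ _)).
  apply: ler_wpM2r; first by rewrite exprn_ge0.
  apply: ler_wpM2r; first by rewrite exprn_ge0.
  rewrite -exprM -!natrX -natrM ler_nat.
  apply: (@leq_trans (2 ^ (k * q) * q.*2.-1 ^ (k * q))).
    by rewrite leq_mul2r leq_exp2l ?bkq ?orbT.
  by rewrite -expnMn; case: (k * q)%N => // kq; rewrite leq_exp2r; lia.
rewrite ler_pXn2r ?nnegrE ?divr_ge0 ?exprn_ge0 //.
by rewrite ler_pdivrMr ?exprn_gt0 ?ltr0n.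
Qed.

(** * Parities along a random hypermatching *)

(** The sum over [S] is the expansion of a product over [j] of factors
    [1 + (-1) ^+ w j * (-1) ^+ w' j], one of which vanishes as soon as [w] and [w'] differ. *)
Lemma sum_characterM (R : comPzRingType) (J : finType) (w w' : {ffun J -> bool}) :
  \sum_(S : {set J}) character R S w * character R S w' =
  (2 ^ #|J|)%:R * (w == w')%:R.
Proof.
transitivity (\prod_(j : J) ((-1) ^+ w j * (-1) ^+ w' j + 1) : R).
  rewrite bigA_distr; apply: eq_bigr => S _.
  by rewrite /character -big_split [LHS]big_mkcond.
have [<-|ww'] := eqVneq w w'.
  under eq_bigr do rewrite -expr2 sqrr_sign.
  by rewrite prodr_const mulr1 natrX.
have /existsP [j wj] : [exists j, w j != w' j].
  apply: contraNT ww' => /existsPn h; apply/eqP/ffunP => j.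
  by apply/eqP; rewrite -[_ == _]negbK h.
rewrite (bigD1 j) //=.
by case: (w j) (w' j) wj => -[] //= _; rewrite !expr1 !expr0 ?mulr1 ?mul1r addNr mul0r mulr0.
Qed.

Lemma parseval (R : comNzRingType) (J : finType) (d : {ffun J -> bool} -> R) :
  \sum_(S : {set J}) (\sum_w d w * character R S w) ^+ 2 =
  (2 ^ #|J|)%:R * \sum_w d w ^+ 2.
Proof.
transitivity (\sum_w \sum_w' d w * d w' *
    \sum_(S : {set J}) character R S w * character R S w').
  under eq_bigr => S _.
    rewrite expr2 mulr_suml.
    under eq_bigr do rewrite mulr_sumr.
    over.
  rewrite exchange_big; apply: eq_bigr => w _.
  rewrite exchange_big; apply: eq_bigr => w' _.
  by rewrite mulr_sumr; apply: eq_bigr => S _; ring.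
rewrite mulr_sumr; apply: eq_bigr => w _.
rewrite (bigD1 w) //= sum_characterM eqxx big1 => [|w' ww'].
  by rewrite addr0 mulr1 -expr2 mulrC.
by rewrite sum_characterM eq_sym (negbTE ww') !mulr0.
Qed.

Definition negv (J : finType) (w : {ffun J -> bool}) : {ffun J -> bool} :=
  [ffun j => ~~ w j].

Lemma character_negv (R : comPzRingType) (J : finType) (S : {set J}) w :
  character R S (negv w) = (-1) ^+ #|S| * character R S w.
Proof.
rewrite /character -prodr_const -big_split /=; apply: eq_bigr => j _.
by rewrite ffunE signrN mulN1r.
Qed.

(** Cauchy-Schwarz against the 0/1 test [D] costs [2 ^ #|J|], which Parseval turns into a sum of
    squared Fourier coefficients. Complementing multiplies the coefficient at [S] by [(-1) ^+ #|S|],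
    so the difference has no coefficient at [set0] and at most twice the original one elsewhere. *)
Lemma advantage_sqr_le (R : realDomainType) (X : finType) (A : {set X}) (J : finType)
    (p : X -> {ffun J -> bool}) (D : {ffun J -> bool} -> bool) :
  (\sum_(x in A) ((D (p x))%:R - (D (negv (p x)))%:R)) ^+ 2 <=
  4 * \sum_(S : {set J} | S != set0) (\sum_(x in A) character R S (p x)) ^+ 2.
Proof.
pose d w : R := \sum_(x in A) ((p x == w)%:R - (negv (p x) == w)%:R).
have pick v (F : {ffun J -> bool} -> R) : \sum_w F w * (v == w)%:R = F v.
  rewrite (bigD1 v) //= eqxx mulr1 big1 ?addr0 // => w /negbTE wv.
  by rewrite eq_sym wv mulr0.
have sum_d (F : {ffun J -> bool} -> R) :
    \sum_w F w * d w = \sum_(x in A) (F (p x) - F (negv (p x))).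
  under eq_bigr do rewrite mulr_sumr.
  rewrite exchange_big; apply: eq_bigr => x _.
  by under eq_bigr do rewrite mulrBr; rewrite sumrB !pick.
rewrite -(sum_d (fun w => (D w)%:R)).
apply: le_trans (cauchy_schwarz _ _) _.
apply: (@le_trans _ _ ((2 ^ #|J|)%:R * \sum_w d w ^+ 2)).
  apply: ler_wpM2r; first by apply: sumr_ge0 => w _; rewrite sqr_ge0.
  have -> : (2 ^ #|J| = #|{: {ffun J -> bool}}|)%N by rewrite card_ffun card_bool.
  rewrite -sum1_card natr_sum; apply: ler_sum => w _.
  by case: (D w); rewrite ?expr1n ?expr0n.
rewrite -parseval (bigD1 set0) //=.
have hat S : \sum_w d w * character R S w =
    (1 - (-1) ^+ #|S|) * \sum_(x in A) character R S (p x).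
  under eq_bigr do rewrite mulrC.
  rewrite sum_d mulr_sumr; apply: eq_bigr => x _.
  by rewrite character_negv mulrBl mul1r.
rewrite hat cards0 expr0 subrr mul0r expr0n add0r mulr_sumr.
apply: ler_sum => S _; rewrite hat exprMn; apply: ler_wpM2r; first exact: sqr_ge0.
by rewrite -signr_odd; case: odd; rewrite ?expr1 ?expr0; lra.
Qed.

(** * Images of a fixed set under a random permutation *)

Lemma exists_perm_imset (V : finType) (E E' : {set V}) :
  #|E| = #|E'| -> exists s : {perm V}, s @: E = E'.
Proof.
(* [q F] lists [F] first and its complement afterwards; the permutation matches the two lists
   position by position. *)
move=> cE; pose q (F : {set V}) := enum F ++ enum (~: F).
have q_uniq F : uniq (q F).
  rewrite cat_uniq !enum_uniq andbT /= -all_predC; apply/allP => x.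
  by rewrite /= !mem_enum inE => ->.
have q_mem F x : x \in q F.
  by rewrite mem_cat !mem_enum inE orbN.
have q_size F : size (q F) = #|V| by rewrite size_cat -!cardE cardsC.
pose s x := nth x (q E') (index x (q E)).
have s_inj : injective s.
  move=> x y; rewrite /s (set_nth_default x) ?q_size; last first.
    by rewrite -(q_size E) index_mem.
  move=> e; have /eqP := e.
  rewrite nth_uniq ?q_size // -?(q_size E) ?index_mem //.
  by move=> /eqP /index_inj; apply.
exists (perm s_inj); apply/eqP; rewrite eqEcard card_imset; last exact: perm_inj.
rewrite cE leqnn andbT; apply/subsetP => _ /imsetP [x xE ->].
rewrite permE /s /q index_cat mem_enum xE nth_cat -cardE -cE cardE.
by rewrite index_mem mem_enum xE -mem_enum mem_nth // -cardE -cE cardE index_mem mem_enum.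
Qed.

Lemma card_all_perms (V : finType) : #|{: {perm V}}| = #|V|`!.
Proof.
rewrite -[in RHS]cardsT -card_perm; apply: eq_card => s.
by rewrite !inE; apply/esym/subsetP => x _; rewrite inE.
Qed.

(** The image of [E] under a uniform permutation is uniform among the sets of its size: by
    transitivity the sum over [s] is the same for every such set, so both sides equal one double
    sum. *)
Lemma sum_perm_imset (R : pzRingType) (V : finType) (F : {set V} -> R) (E : {set V}) :
  ('C(#|V|, #|E|))%:R * (\sum_(s : {perm V}) F (s @: E)) =
  (#|V|`!)%:R * \sum_(T : {set V} | #|T| == #|E|) F T.
Proof.
transitivity (\sum_(T : {set V} | #|T| == #|E|) \sum_(s : {perm V}) F (s @: T)).
  rewrite -card_draws mulr_natl -sumr_const.
  rewrite (eq_bigl (fun T : {set V} => #|T| == #|E|)); last by move=> T; rewrite inE.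
  apply: eq_bigr => T /eqP /esym /exists_perm_imset [r <-].
  rewrite [LHS](reindex_inj (mulgI r)); apply: eq_bigr => s _.
  congr F; rewrite -imset_comp; apply: eq_imset => x /=.
  by rewrite permM.
rewrite exchange_big /=.
transitivity (\sum_(s : {perm V}) \sum_(T : {set V} | #|T| == #|E|) F T).
  apply: eq_bigr => s _.
  rewrite [RHS](reindex_inj (imset_inj (@perm_inj _ s))).
  by apply: eq_bigl => T; rewrite card_imset //; exact: perm_inj.
by rewrite sumr_const card_all_perms mulr_natl.
Qed.

(** Unnormalised: this is [4 ^ #|V|] times the usual Fourier weight of the indicator of [A] at level
    [k]. *)
Definition level_weight (R : pzRingType) (V : finType) (A : {set {ffun V -> bool}}) k : R :=
  \sum_(T : {set V} | #|T| == k) (\sum_(x in A) character R T x) ^+ 2.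

(** A random hypermatching is encoded as a fixed layout [slot] followed by a random permutation
    [pi]: the [i]-th index of hyperedge [j] is [pi (slot (j, i))], and indices outside the image are
    unmatched. *)
Definition edge_parity (J P V : finType) (slot : J * P -> V) (pi : {perm V})
    (x : {ffun V -> bool}) : {ffun J -> bool} :=
  [ffun j => \big[addb/false]_(i : P) x (pi (slot (j, i)))].

Lemma character_edge_parity (R : comPzRingType) (J P V : finType) (slot : J * P -> V)
    (pi : {perm V}) (S : {set J}) x : injective slot ->
  character R S (edge_parity slot pi x) =
  character R (pi @: (slot @: setX S [set: P])) x.
Proof.
move=> slot_inj; rewrite /character.
rewrite big_imset; last by move=> a b _ _; exact: perm_inj.
rewrite big_imset /=; last by move=> a b _ _; exact: slot_inj.
transitivity (\prod_(j in S) \prod_(i : P) (-1) ^+ x (pi (slot (j, i))) : R).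
  apply: eq_bigr => j _; rewrite ffunE.
  by rewrite (big_morph (fun b : bool => (-1) ^+ b : R) (id1 := 1) (op1 := *%R)) //;
    apply: signr_addb.
rewrite pair_big_dep; apply: eq_big => [[j i]|[j i] _] //=.
by rewrite !inE andbT.
Qed.

(** By [character_edge_parity] only unions of hyperedges matter. Such a union of [l] hyperedges is a
    uniform set of size [l * #|P|] as [s] varies, and there are ['C(#|J|, l)] of them. *)
Lemma sum_advantage_sqr_le (R : realFieldType) (J P V : finType) (slot : J * P -> V)
    (A : {set {ffun V -> bool}}) (D : {perm V} -> {ffun J -> bool} -> bool) :
  injective slot ->
  \sum_(s : {perm V}) (\sum_(x in A) ((D s (edge_parity slot s x))%:R -
      (D s (negv (edge_parity slot s x)))%:R)) ^+ 2 <=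
  4 * (#|V|`!)%:R * \sum_(1 <= l < #|J|.+1)
     ('C(#|J|, l))%:R / ('C(#|V|, l * #|P|))%:R * level_weight R A (l * #|P|).
Proof.
move=> slot_inj.
apply: (@le_trans _ _ (\sum_(s : {perm V}) 4 * \sum_(S : {set J} | S != set0)
   (\sum_(x in A) character R (s @: (slot @: setX S [set: P])) x) ^+ 2)).
  apply: ler_sum => s _; apply: le_trans (advantage_sqr_le _ _ _ _) _.
  apply: ler_wpM2l => //; apply: ler_sum => S _.
  by under eq_bigr do rewrite character_edge_parity //.
rewrite -mulr_sumr -mulrA; apply: ler_wpM2l => //.
rewrite exchange_big mulr_sumr /=.
pose G l : R := (#|V|`!)%:R / ('C(#|V|, l * #|P|))%:R * level_weight R A (l * #|P|).
have cE (S : {set J}) : #|slot @: setX S [set: P]| = (#|S| * #|P|)%N.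
  by rewrite card_imset // cardsX cardsT.
have card_le : (#|J| * #|P| <= #|V|)%N.
  by rewrite -card_prod; exact: leq_card slot_inj.
rewrite (eq_bigr (fun S : {set J} => G #|S|)); last first.
  move=> S _; rewrite /G /level_weight -cE.
  have C0 : ('C(#|V|, #|slot @: setX S [set: P]|))%:R != 0 :> R.
    rewrite pnatr_eq0 -lt0n bin_gt0 cE; apply: leq_trans card_le.
    by rewrite leq_mul2r max_card orbT.
  apply: (mulfI C0); rewrite (sum_perm_imset
    (fun T => (\sum_(x in A) character R T x) ^+ 2)).
  by rewrite mulrA (mulrC _ (_ / _)) divfK // cE.
have cS (S : {set J}) : (#|S| < #|J|.+1)%N by rewrite ltnS max_card.
rewrite (partition_big (fun S : {set J} => Ordinal (cS S)) (fun l => l != ord0)) /=; last first.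
  by move=> S S0; rewrite -val_eqE /= cards_eq0.
rewrite big_add1 /= big_mkord [X in X <= _]big_mkcond big_ord_recl eqxx /= add0r.
apply: ler_sum => l _.
rewrite (eq_bigr (fun _ => G l.+1)); last first.
  by move=> S /andP[_ /eqP /(congr1 val)] /= ->; rewrite /bump add1n.
rewrite sumr_const -mulr_natl /G.
have -> : #|[pred S : {set J} | (S != set0) && (Ordinal (cS S) == lift ord0 l)]| =
    'C(#|J|, l.+1).
  rewrite -card_draws cardsE; apply: eq_card => S.
  rewrite [LHS]inE [RHS]inE -cards_eq0 -(inj_eq val_inj) /=.
  rewrite /bump add1n -[RHS]/(#|S| == l.+1).
  by case: (#|S| =P l.+1) => [->|_]; rewrite ?andbF.
by rewrite le_eqVlt; apply/orP; left; apply/eqP; ring.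
Qed.

Lemma sum_advantage_le (R : realFieldType) (J P V : finType) (slot : J * P -> V)
    (A : {set {ffun V -> bool}}) (D : {perm V} -> {ffun J -> bool} -> bool) (delta : R) :
  injective slot -> 0 < delta ->
  4 * \sum_(1 <= l < #|J|.+1) ('C(#|J|, l))%:R / ('C(#|V|, l * #|P|))%:R *
      level_weight R A (l * #|P|) <= delta ^+ 2 * #|A|%:R ^+ 2 ->
  \sum_(s : {perm V}) \sum_(x in A) ((D s (edge_parity slot s x))%:R -
      (D s (negv (edge_parity slot s x)))%:R) <=
  (#|V|`!)%:R * #|A|%:R * delta.
Proof.
move=> slot_inj delta0 hG.
have [A0|A0] := posnP #|A|.
  rewrite A0 mulr0 mul0r big1 // => s _.
  by rewrite (cards0_eq A0) big_set0.
(* The passage from second to first moments over [s] is Cauchy-Schwarz, done without roots as AM-GM;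
   [lam] is the target mean value. *)
pose lam : R := delta * #|A|%:R.
have lam0 : 0 < lam by rewrite mulr_gt0 // ltr0n.
have amgm (z : R) : z <= (lam + z ^+ 2 / lam) / 2.
  rewrite ler_pdivlMr // -(@ler_pM2r _ lam) // mulrDl divfK ?gt_eqF //.
  rewrite -subr_ge0 (_ : _ - _ = (lam - z) ^+ 2) ?sqr_ge0 //; ring.
apply: le_trans (ler_sum _ (fun s _ => amgm _)) _.
rewrite -mulr_suml big_split /= sumr_const -[X in _ + X]mulr_suml.
rewrite card_all_perms.
have := sum_advantage_sqr_le R A D slot_inj; set Z := \sum_(s : _) _ => hZ.
have {}hZ : Z <= (#|V|`!)%:R * lam ^+ 2.
  apply: (le_trans hZ); rewrite mulrAC mulrC; apply: ler_wpM2l => //.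
  by rewrite /lam exprMn.
rewrite ler_pdivrMr // -(mulr_natl lam).
have : Z / lam <= (#|V|`!)%:R * lam by rewrite ler_pdivrMr // -mulrA -expr2.
rewrite (_ : _ * _ * delta = (#|V|`!)%:R * lam); last by rewrite /lam; ring.
lra.
Qed.

(** * Binomial estimates and the sum over levels *)

Lemma leq_bin_ratio a b l : (a <= b)%N -> ('C(a, l) * b ^ l <= a ^ l * 'C(b, l))%N.
Proof.
move=> ab; elim: l => [|l IH]; first by rewrite !bin0 !expn0.
rewrite -(@leq_pmul2l l.+1) // mulnA mul_bin_left mulnCA mul_bin_left !expnS.
rewrite (_ : _ * (b * _) = (a - l) * b * ('C(a, l) * b ^ l))%N; last first.
  by move: (a - l)%N => u; ring.
rewrite (_ : _ * ((b - l) * _) = a * (b - l) * (a ^ l * 'C(b, l)))%N; last first.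
  by move: (b - l)%N => u; ring.
by apply: leq_mul IH; nia.
Qed.

Lemma leq_bin_mul a b c d : ('C(a, c) * 'C(b, d) <= 'C(a + b, c + d))%N.
Proof.
rewrite -binomial.Vandermonde (bigD1 (inord c : 'I_(c + d).+1)) //= inordK; last by lia.
by rewrite addKn leq_addr.
Qed.

(** Choosing [l] elements in each of [t] disjoint blocks of size [a] is one way of choosing [l * t]
    among [a * t]. *)
Lemma leq_bin_expn a l t : ('C(a, l) ^ t <= 'C(a * t, l * t))%N.
Proof.
elim: t => [|t IH]; first by rewrite !muln0 bin0.
rewrite expnS !mulnS; apply: leq_trans (leq_bin_mul _ _ _ _).
by rewrite leq_mul2l IH orbT.
Qed.

Lemma sum_expr_le (R : realFieldType) (x : R) N :
  0 <= x -> x < 1 -> \sum_(i < N) x ^+ i <= (1 - x)^-1.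
Proof.
move=> x0 x1; rewrite -[leRHS]mul1r ler_pdivlMr ?subr_gt0 //.
have := subrX1 x N; have := exprn_ge0 N x0; lra.
Qed.

(** Parseval over all levels at once; it replaces [level_inequality] at high levels. *)
Lemma level_weight_trivial (R : realFieldType) (V : finType)
    (A : {set {ffun V -> bool}}) k b : (2 ^ #|V| <= #|A| * 2 ^ b)%N ->
  level_weight R A k <= (2 ^ b)%:R * #|A|%:R ^+ 2.
Proof.
move=> hA.
apply: (@le_trans _ _ (\sum_(T : {set V}) (\sum_(x in A) character R T x) ^+ 2)).
  rewrite /level_weight big_mkcond; apply: ler_sum => T _.
  by case: ifP => // _; exact: sqr_ge0.
under eq_bigr => T _.
  rewrite big_mkcond (eq_bigr (fun x => (x \in A)%:R * character R T x)); last first.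
    by move=> x _; case: (x \in A); rewrite ?mul1r ?mul0r.
  over.
rewrite parseval expr2 mulrA.
have -> : \sum_w (w \in A)%:R ^+ 2 = #|A|%:R :> R.
  rewrite -sum1_card natr_sum [RHS]big_mkcond; apply: eq_bigr => x _.
  by case: (x \in A); rewrite ?expr1n ?expr0n.
by apply: ler_wpM2r => //; rewrite -natrM ler_nat mulnC.
Qed.

(** Two ranges of [l]. Up to [kappa * b] the level inequality bounds the term by [theta ^+ l].
    Beyond, the trivial weight bound loses [2 ^ b], which the decay [r ^+ l <= 4^-1 ^+ b] outweighs.
    Both resulting series are geometric. *)
Lemma sum_level_weight_le (R : realFieldType) (V : finType)
    (A : {set {ffun V -> bool}}) (m m' t b kappa : nat) (r : R) :
  (0 < t)%N -> (m' * t <= #|V|)%N -> 0 < r -> r < 1 -> m%:R <= r ^+ 2 * m'%:R ->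
  (0 < kappa)%N -> r ^+ kappa <= 4^-1 -> (2 ^ #|V| <= #|A| * 2 ^ b)%N ->
  let theta := (4 * kappa.+1 * b)%:R ^+ t / m'%:R ^+ t.-1 : R in
  theta <= 2^-1 ->
  \sum_(1 <= l < m.+1) ('C(m, l))%:R / ('C(#|V|, l * t))%:R * level_weight R A (l * t)
  <= (2 * theta + 2^-1 ^+ b / (1 - r)) * #|A|%:R ^+ 2.
Proof.
move=> t0 hV r0 r1 hm k0 rk hA theta theta2.
have theta0 : 0 <= theta by rewrite divr_ge0 ?exprn_ge0.
have r21 : r ^+ 2 <= 1 by rewrite expr_le1 // ltW.
have mm' : (m <= m')%N.
  rewrite -(ler_nat R); apply: (le_trans hm).
  by rewrite -[leRHS]mul1r ler_wpM2r.
have term l : (0 < l <= m)%N ->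
    ('C(m, l))%:R / ('C(#|V|, l * t))%:R * level_weight R A (l * t) <=
    (theta ^+ l + r ^+ l * 2^-1 ^+ b) * #|A|%:R ^+ 2.
  move=> /andP[l0 lm].
  have W0 : 0 <= level_weight R A (l * t) by apply: sumr_ge0 => T _; exact: sqr_ge0.
  have lm' : (l <= m')%N := leq_trans lm mm'.
  have m'0 : (0 < m')%N by lia.
  have c0 : (0 < 'C(m', l))%N by rewrite bin_gt0.
  have c0R : 0 < ('C(m', l))%:R :> R by rewrite ltr0n.
  (* The slack between [m] and [m'] gives [r ^+ l.*2]: for large [l], one factor [r ^+ l] beats the
     trivial weight bound and the other makes the series converge. *)
  have e1 : ('C(m, l))%:R <= r ^+ l.*2 * ('C(m', l))%:R.
    have m'l : 0 < m'%:R ^+ l :> R by rewrite exprn_gt0 ?ltr0n.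
    rewrite -(ler_pM2r m'l) -natrX -natrM.
    apply: (@le_trans _ _ (m ^ l * 'C(m', l))%:R).
      by rewrite ler_nat leq_bin_ratio.
    rewrite natrM !natrX mulrAC; apply: ler_wpM2r => //.
    by rewrite -mul2n exprM -exprMn lerXn2r // nnegrE ?mulr_ge0 ?exprn_ge0 // ltW.
  have e2 : ('C(m', l))%:R ^+ t <= ('C(#|V|, l * t))%:R :> R.
    rewrite -natrX ler_nat; apply: (leq_trans (leq_bin_expn _ _ _)).
    exact: leq_bin2l.
  have e3 : ('C(m, l))%:R / ('C(#|V|, l * t))%:R <= r ^+ l.*2 / ('C(m', l))%:R ^+ t.-1.
    rewrite ler_pdivrMr; last by apply: lt_le_trans e2; rewrite exprn_gt0.
    apply: (le_trans e1); rewrite -mulrA; apply: ler_wpM2l.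
      by rewrite exprn_ge0 // ltW.
    rewrite mulrC ler_pdivlMr ?exprn_gt0 // -exprS prednK //.
  apply: (@le_trans _ _ (r ^+ l.*2 / ('C(m', l))%:R ^+ t.-1 * level_weight R A (l * t))).
    by apply: ler_wpM2r.
  rewrite mulrDl.
  have [lk|kl] := leqP l (kappa * b).
    apply: (@le_trans _ _ (theta ^+ l * #|A|%:R ^+ 2)); last first.
      by rewrite lerDl !mulr_ge0 ?exprn_ge0 ?invr_ge0 // ltW.
    (* The least [q] with [b < l * t * q], as the level inequality needs; in this range it still
       satisfies [l * q <= kappa.+1 * b]. *)
    pose q := (b %/ (l * t)).+1.
    have lt0 : (0 < l * t)%N by rewrite muln_gt0 l0.
    have bq : (b <= l * t * q)%N by rewrite mulnC ltnW // ltn_ceil.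
    have := level_inequality R (isT : (0 < q)%N) bq hA.
    rewrite -/(level_weight R A (l * t)) => hW.
    apply: (le_trans (ler_wpM2l _ hW)).
      by rewrite divr_ge0 ?exprn_ge0 // ltW.
    rewrite mulrA; apply: ler_wpM2r; first by rewrite exprn_ge0.
    rewrite mulrAC ler_pdivrMr ?exprn_gt0 //.
    have b1 : r ^+ l.*2 <= 1 by rewrite exprn_ile1 // ltW.
    apply: (@le_trans _ _ ((4 * q)%:R ^+ (l * t))).
      by rewrite -[leRHS]mul1r; apply: ler_wpM2r => //; rewrite exprn_ge0.
    have lq : (l * q <= kappa.+1 * b)%N.
      rewrite /q mulnS mulSn addnC.
      apply: leq_add lk; apply: leq_trans (leq_trunc_div b (l * t)).
      by rewrite mulnC leq_mul2l leq_pmulr ?orbT.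
    rewrite /theta expr_div_n -!natrX mulrAC ler_pdivlMr; last first.
      by rewrite ltr0n !expn_gt0 m'0.
    rewrite -!natrM ler_nat -!expnM.
    (* That is, [(m' / l) ^ l <= 'C(m', l)]; the powers of [l] join those of [q], so that only
       [l * q] remains. *)
    have ml : (m' ^ l <= l ^ l * 'C(m', l))%N.
      by have := leq_bin_ratio l lm'; rewrite binn mul1n.
    apply: (@leq_trans ((4 * q) ^ (l * t) * (l ^ l * 'C(m', l)) ^ t.-1)).
      rewrite leq_mul2l; apply/orP; right; rewrite (mulnC t.-1) expnM.
      by case: t.-1 => // u; rewrite leq_exp2r.
    rewrite (expnMn (l ^ l)) mulnA leq_mul2r; apply/orP; right.
    rewrite -expnM; apply: (@leq_trans ((4 * q) ^ (l * t) * l ^ (l * t))).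
      by rewrite leq_mul2l leq_pexp2l ?orbT // leq_mul2l leq_pred orbT.
    rewrite -expnMn (mulnC t l) leq_exp2r // -!mulnA leq_mul2l.
    by rewrite (mulnC q) lq orbT.
  apply: (@le_trans _ _ (r ^+ l * 2^-1 ^+ b * #|A|%:R ^+ 2)); last first.
    by rewrite lerDr !mulr_ge0 ?exprn_ge0.
  apply: (@le_trans _ _ (r ^+ l.*2 * ((2 ^ b)%:R * #|A|%:R ^+ 2))).
    rewrite mulrAC -mulrA; apply: ler_wpM2l; first by rewrite exprn_ge0 // ltW.
    apply: le_trans _ (level_weight_trivial R (l * t) hA).
    rewrite ler_pdivrMr ?exprn_gt0 // ler_peMr //.
    by rewrite -natrX ler1n expn_gt0 c0.
  rewrite mulrA; apply: ler_wpM2r; first by rewrite exprn_ge0.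
  rewrite -addnn exprD -mulrA; apply: ler_wpM2l; first by rewrite exprn_ge0 // ltW.
  have rb : r ^+ l <= 4^-1 ^+ b.
    apply: (@le_trans _ _ ((r ^+ kappa) ^+ b)).
      by rewrite -exprM; apply: ler_wiXn2l; [exact: ltW|exact: ltW|exact: ltnW].
    by rewrite lerXn2r // nnegrE ?exprn_ge0 // ?invr_ge0 // ltW.
  apply: (le_trans (ler_wpM2r _ rb)) => //.
  by rewrite natrX -exprMn (_ : 4^-1 * 2 = 2^-1) //; field.
rewrite big_add1 /= big_mkord.
apply: (@le_trans _ _ (\sum_(l < m) (theta ^+ l.+1 + r ^+ l.+1 * 2^-1 ^+ b) * #|A|%:R ^+ 2)).
  by apply: ler_sum => l _; apply: term; rewrite /= ltn_ord.
rewrite -mulr_suml; apply: ler_wpM2r; first by rewrite exprn_ge0.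
rewrite big_split /=; apply: lerD.
  under eq_bigr do rewrite exprS.
  rewrite -mulr_sumr mulrC; apply: ler_wpM2r => //.
  apply: (le_trans (sum_expr_le _ theta0 _)); first by lra.
  by rewrite -[leRHS]invrK lef_pV2 ?posrE; lra.
rewrite -mulr_suml mulrC; apply: ler_wpM2l; first by rewrite exprn_ge0 ?invr_ge0.
apply: le_trans _ (sum_expr_le m (ltW r0) r1).
apply: ler_sum => l _; rewrite exprS -[leRHS]mul1r.
by apply: ler_wpM2r; [rewrite exprn_ge0 // ltW | exact: ltW].
Qed.

(** Conditioning on the message splits the inputs into the fibres of [enc]. A fibre of density at
    least [2 ^ -b] is covered by [sum_advantage_le]; a smaller one contributes at most its size, and
    there are at most [#|Z|] of them. *)
Lemma protocol_advantage_le (R : realFieldType) (J P V Z : finType) (slot : J * P -> V)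
    (enc : {ffun V -> bool} -> Z)
    (D : Z -> {perm V} -> {ffun J -> bool} -> bool) (b : nat) (delta : R) :
  injective slot -> 0 < delta ->
  (forall A : {set {ffun V -> bool}}, (2 ^ #|V| <= #|A| * 2 ^ b)%N ->
     4 * \sum_(1 <= l < #|J|.+1) ('C(#|J|, l))%:R / ('C(#|V|, l * #|P|))%:R *
        level_weight R A (l * #|P|) <= delta ^+ 2 * #|A|%:R ^+ 2) ->
  \sum_(s : {perm V}) \sum_x ((D (enc x) s (edge_parity slot s x))%:R -
      (D (enc x) s (negv (edge_parity slot s x)))%:R) <=
  (#|V|`!)%:R * (2 ^ #|V|)%:R * (delta + #|Z|%:R / (2 ^ b)%:R).
Proof.
move=> slot_inj delta0 hA; pose N : R := (#|V|`!)%:R.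
pose A z := [set x | enc x == z].
pose T z : R := \sum_(s : {perm V}) \sum_(x in A z)
  ((D z s (edge_parity slot s x))%:R - (D z s (negv (edge_parity slot s x)))%:R).
have -> : \sum_(s : {perm V}) \sum_x ((D (enc x) s (edge_parity slot s x))%:R -
      (D (enc x) s (negv (edge_parity slot s x)))%:R) = \sum_z T z.
  rewrite [RHS]exchange_big; apply: eq_bigr => s _.
  rewrite (partition_big enc xpredT) //=; apply: eq_bigr => z _.
  by apply: eq_big => [x|x /eqP ->] //; rewrite inE.
have b0 : 0 < (2 ^ b)%:R :> R by rewrite ltr0n expn_gt0.
have Tle z : T z <= N * (#|A z|%:R * delta + (2 ^ #|V|)%:R / (2 ^ b)%:R).
  have [big|small] := leqP (2 ^ #|V|) (#|A z| * 2 ^ b).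
    have := sum_advantage_le (D z) slot_inj delta0 (hA _ big).
    move=> /le_trans; apply; rewrite -mulrA; apply: ler_wpM2l => //.
    by rewrite lerDl divr_ge0.
  apply: (@le_trans _ _ (N * #|A z|%:R)).
    rewrite /T /N.
    apply: (@le_trans _ _ (\sum_(s : {perm V}) #|A z|%:R)).
      apply: ler_sum => s _; rewrite -sum1_card natr_sum; apply: ler_sum => x _.
      by case: (D z s _); case: (D z s _); rewrite /=; lra.
    by rewrite sumr_const card_all_perms mulr_natl.
  apply: ler_wpM2l => //; apply: (@le_trans _ _ ((2 ^ #|V|)%:R / (2 ^ b)%:R)).
    by rewrite ler_pdivlMr // -natrM ler_nat ltnW.
  by rewrite lerDr mulr_ge0 // ltW.
apply: le_trans (ler_sum _ (fun z _ => Tle z)) _.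
rewrite -mulr_sumr -mulrA; apply: ler_wpM2l => //.
rewrite big_split /= -mulr_suml sumr_const mulrDr; apply: lerD.
  apply: ler_wpM2r; first exact: ltW.
  rewrite -natr_sum ler_nat.
  have -> : (\sum_z #|A z| = #|{: {ffun V -> bool}}|)%N.
    rewrite -sum1_card (partition_big enc xpredT) //=; apply: eq_bigr => z _.
    by rewrite -sum1_card; apply: eq_bigl => x; rewrite inE.
  by rewrite card_ffun card_bool.
have -> : #|(xpredT : pred Z)| = #|Z| by apply: eq_card.
by rewrite -[leLHS]mulr_natl mulrCA.
Qed.

Lemma hypermatching_advantage_le (R : realFieldType) (n m t : nat)
    (slot : 'I_m * 'I_t -> 'I_n) (Z : finType) (enc : {ffun 'I_n -> bool} -> Z)
    (D : Z -> {perm 'I_n} -> {ffun 'I_m -> bool} -> bool) (b kappa : nat) (r delta : R) :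
  injective slot -> (0 < t)%N -> 0 < delta -> 0 < r -> r < 1 ->
  m%:R <= r ^+ 2 * (n %/ t)%:R -> (0 < kappa)%N -> r ^+ kappa <= 4^-1 ->
  let theta := (4 * kappa.+1 * b)%:R ^+ t / (n %/ t)%:R ^+ t.-1 : R in
  theta <= 2^-1 -> 4 * (2 * theta + 2^-1 ^+ b / (1 - r)) <= delta ^+ 2 ->
  \sum_(s : {perm 'I_n}) \sum_x ((D (enc x) s (edge_parity slot s x))%:R -
      (D (enc x) s (negv (edge_parity slot s x)))%:R) <=
  (n`!)%:R * (2 ^ n)%:R * (delta + #|Z|%:R / (2 ^ b)%:R).
Proof.
move=> slot_inj t0 d0 r0 r1 hm k0 rk theta theta2 small.
have := @protocol_advantage_le R _ _ _ _ slot enc D b delta slot_inj d0.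
rewrite !card_ord; apply=> A hA.
apply: (@le_trans _ _ (4 * ((2 * theta + 2^-1 ^+ b / (1 - r)) * #|A|%:R ^+ 2))).
  apply: ler_wpM2l => //.
  have := @sum_level_weight_le R _ A m (n %/ t) t b kappa r t0.
  by rewrite card_ord; apply=> //; exact: leq_trunc_div.
by rewrite mulrA; apply: ler_wpM2r => //; rewrite exprn_ge0.
Qed.

(** * Spectrum of the gadget *)

(** A discrete Poincaré inequality for antiperiodic sequences. With total variation [L], the sign
    change over one turn gives [2 |z 0| <= L], hence [|z k| <= 3/2 L] for all [k]; Cauchy-Schwarz
    bounds [L ^+ 2] by the sum of squares. *)
Lemma cycle_gap (R : realFieldType) (t : nat) (z : nat -> R) : z t = - z 0%N ->
  \sum_(k < t) z k ^+ 2 <= 3 * t%:R ^+ 2 * \sum_(k < t) (z k - z k.+1) ^+ 2.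
Proof.
move=> zt; pose L : R := \sum_(k < t) `|z k - z k.+1|.
have tele k : (k <= t)%N -> `|z 0%N - z k| <= L.
  move=> kt; have -> : z 0%N - z k = \sum_(i < k) (z i - z i.+1).
    elim: k {kt} => [|k IH]; first by rewrite big_ord0 subrr.
    by rewrite big_ord_recr /= -IH; ring.
  apply: (le_trans (ler_norm_sum _ _ _)).
  rewrite /L -(subnKC kt) big_split_ord /= lerDl; apply: sumr_ge0 => *; exact: normr_ge0.
have z0 : `|z 0%N| * 2 <= L.
  have := tele t (leqnn t); by rewrite zt opprK -mulr2n normrMn mulr_natr.
have zk (k : 'I_t) : z k ^+ 2 <= 3 * L ^+ 2.
  have L0 : 0 <= L by apply: sumr_ge0.
  have h : `|z k| <= 3 / 2 * L.
    have := tele k (ltnW (ltn_ord k)).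
    have := ler_normD (z 0%N) (- (z 0%N - z k)).
    by rewrite normrN opprB addrC subrK; lra.
  rewrite -real_normK ?num_real //.
  apply: (@le_trans _ _ ((3 / 2 * L) ^+ 2)).
    by apply: lerXn2r => //; rewrite nnegrE //; lra.
  by rewrite exprMn; apply: ler_wpM2r; [exact: sqr_ge0 | lra].
have L2 : L ^+ 2 <= t%:R * \sum_(k < t) (z k - z k.+1) ^+ 2.
  have := cauchy_schwarz (fun k : 'I_t => `|z k - z k.+1|) (fun=> 1).
  under eq_bigr do rewrite mulr1.
  rewrite -/L [X in _ * X](eq_bigr (fun=> 1)) => [|k _]; last by rewrite expr1n.
  rewrite sumr_const card_ord mulrC => /le_trans; apply; apply: ler_wpM2l => //.
  by apply: ler_sum => k _; rewrite real_normK ?num_real.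
apply: (le_trans (ler_sum _ (fun k _ => zk k))).
rewrite sumr_const card_ord -(mulr_natl (3 * _)) mulrCA -[leRHS]mulrA.
apply: ler_wpM2l => //.
by rewrite expr2 -mulrA; apply: ler_wpM2l.
Qed.

(** Geometric multiplicity is at most algebraic multiplicity; the rows of [V] are independent left
    eigenvectors. *)
Lemma dvdp_char_poly (F : fieldType) (m n : nat) (V : 'M[F]_(m, n)) (M : 'M[F]_n) a :
  row_free V -> V *m M = a *: V -> ('X - a%:P) ^+ m %| char_poly M.
Proof.
move=> Vfree VM; pose P := row_ebase V.
have mn : (m <= n)%N by rewrite -(eqP Vfree) rank_leq_col.
have rV : \rank V = m by apply/eqP.
have pidP : pid_mx m *m P *m M = a *: (pid_mx m *m P :> 'M_(m, n)).
  have -> : (pid_mx m *m P :> 'M_(m, n)) = invmx (col_ebase V) *m V.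
    have e := mulmx_ebase V; rewrite rV -mulmxA in e.
    exact: (canRL (mulKmx (col_ebase_unit V)) e).
  by rewrite -mulmxA VM -scalemxAr.
have rowPM (i : 'I_m) : row (widen_ord mn i) P *m M = a *: row (widen_ord mn i) P.
  have rowi : row i (pid_mx m *m P :> 'M_(m, n)) = row (widen_ord mn i) P.
    apply/rowP => k; rewrite !mxE (bigD1 (widen_ord mn i)) //= !mxE eqxx /=.
    rewrite ltn_ord mul1r big1 ?addr0 // => l li; rewrite !mxE.
    case: eqP => [il|]; last by rewrite mul0r.
    by rewrite -(inj_eq val_inj) /= -il eqxx in li.
  by rewrite -rowi -row_mul pidP; apply/rowP => k; rewrite !mxE.
(* [P] completes the row space of [V] to a basis. The first [m] rows of [Q] are ['X - a%:P] times
   those of [P], and taking determinants pulls these factors out. *)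
pose Q := map_mx polyC P *m char_poly_mx M.
pose D : 'rV[{poly F}]_n := \row_i (if (i < m)%N then 'X - a%:P else 1).
pose N : 'M[{poly F}]_n := \matrix_(i, k) (if (i < m)%N then (P i k)%:P else Q i k).
have QE : Q = diag_mx D *m N.
  apply/matrixP => i k; rewrite mul_diag_mx !mxE; case: ifP => im; last first.
    by rewrite mul1r.
  have := rowPM (Ordinal im).
  have -> : widen_ord mn (Ordinal im) = i by apply: val_inj.
  move=> /rowP /(_ k); rewrite !mxE => h.
  rewrite mulrBl -polyCM -h rmorph_sum /=.
  under eq_bigr do rewrite !mxE mulrBr.
  rewrite sumrB; congr (_ - _).
    rewrite (bigD1 k) // eqxx mulr1n -[RHS]addr0 (mulrC _ 'X); congr (_ + _).
    by apply: big1 => l /negbTE lk; rewrite lk mulr0n mulr0.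
  by apply: eq_bigr => l _; rewrite mxE polyCM.
have detQ : \det Q = (\det P)%:P * char_poly M.
  by rewrite det_mulmx det_map_mx.
have detP : \det P != 0 by rewrite -unitfE -unitmxE row_ebase_unit.
have detD : \det (diag_mx D) = ('X - a%:P) ^+ m.
  rewrite det_diag.
  under eq_bigr do rewrite mxE.
  rewrite (bigID (fun i : 'I_n => (i < m)%N)) /=.
  rewrite [X in _ * X]big1 ?mulr1 => [|i /negbTE -> //].
  rewrite (eq_bigr (fun _ => 'X - a%:P)) => [|i -> //].
  rewrite prodr_const; congr (_ ^+ _).
  rewrite -[RHS]card_ord -(card_imset (f := widen_ord mn)); last first.
    by move=> i j /(congr1 val) /= /val_inj.
  apply: eq_card => i.
  apply/idP/imsetP => [im|[j _ ->]]; last exact: (ltn_ord j).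
  by exists (Ordinal (im : (i < m)%N)) => //; apply: val_inj.
have : ('X - a%:P) ^+ m %| (\det P)%:P * char_poly M.
  by rewrite -detQ QE det_mulmx detD dvdp_mulIl.
by rewrite mul_polyC dvdpZr.
Qed.

(** The Rayleigh quotient: an eigenvector [v] satisfies [lambda |v|^2 = |A v|^2]. *)
Lemma gram_eigenvalue_le (R : realFieldType) (n : nat) (A : 'M[R]_n) (b : R) :
  (forall v : 'rV_n, \sum_r (\sum_c A r c * v 0 c) ^+ 2 <= b * \sum_c v 0 c ^+ 2) ->
  forall lambda, root (char_poly (A^T *m A)) lambda -> lambda <= b.
Proof.
move=> hA lambda; rewrite -eigenvalue_root_char => /eigenvalueP [v hv v0].
have v2 : 0 < \sum_c v 0 c ^+ 2.
  rewrite lt_def sumr_ge0 ?andbT => [|c _]; last exact: sqr_ge0.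
  apply: contraNneq v0 => s0; apply/eqP/rowP => c; rewrite mxE.
  apply/eqP; rewrite -sqrf_eq0; apply/eqP.
  by apply: (psumr_eq0P _ s0) => // k _; exact: sqr_ge0.
have e : lambda * \sum_c v 0 c ^+ 2 = \sum_r (\sum_c A r c * v 0 c) ^+ 2.
  have : (v *m (A^T *m A) *m v^T) 0 0 = (lambda *: v *m v^T) 0 0 by rewrite hv.
  rewrite mulmxA -[v *m A^T *m A *m v^T]mulmxA -scalemxAl !mxE.
  have -> : \sum_j v 0 j * v^T j 0 = \sum_c v 0 c ^+ 2.
    by apply: eq_bigr => c _; rewrite mxE expr2.
  move=> <-; apply: eq_bigr => r _; rewrite !mxE expr2.
  by congr (_ * _); apply: eq_bigr => c _; rewrite !mxE // mulrC.
by have := hA v; rewrite -e ler_pM2r.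
Qed.

Lemma delta_sum_mulr (R : comPzRingType) (K : finType) (n : nat) (a : K -> R)
    (p q : K -> 'I_n) (y : 'I_n -> R) r :
  \sum_c (\sum_k a k *: delta_mx (p k) (q k) : 'M_n) r c * y c =
  \sum_(k | p k == r) a k * y (q k).
Proof.
under eq_bigr do rewrite summxE mulr_suml.
rewrite exchange_big [RHS]big_mkcond; apply: eq_bigr => k _ /=.
rewrite (bigD1 (q k)) //= !mxE eqxx andbT big1 ?addr0 => [|c /negbTE cq].
  by rewrite eq_sym; case: eqP; rewrite ?mulr1 ?mulr0 ?mul0r.
by rewrite !mxE cq andbF mulr0 mul0r.
Qed.

Lemma delta_sum_mull (R : comPzRingType) (K : finType) (n : nat) (a : K -> R)
    (p q : K -> 'I_n) (y : 'I_n -> R) c :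
  \sum_r y r * (\sum_k a k *: delta_mx (p k) (q k) : 'M_n) r c =
  \sum_(k | q k == c) a k * y (p k).
Proof.
rewrite -delta_sum_mulr; apply: eq_bigr => r _; rewrite mulrC; congr (_ * _).
rewrite !summxE; apply: eq_bigr => k _; rewrite !mxE; congr (_ * _).
by rewrite andbC.
Qed.

Lemma big_codom (V : nmodType) (K L : finType) (e : K -> L) (F : L -> V) :
  injective e ->
  \sum_r F r = \sum_k F (e k) + \sum_(r | r \notin codom e) F r.
Proof.
move=> e_inj; rewrite (bigID (mem (codom e))) /=; congr (_ + _).
rewrite -(big_imset F (h := e) (A := predT)) => [|a b _ _]; last exact: e_inj.
apply: eq_bigl => r; apply/codomP/imsetP => [[k ->]|[k _ ->]]; by exists k.
Qed.

Definition next (m t : nat) (ji : 'I_m * 'I_t) : 'I_m * 'I_t := (ji.1, ordS ji.2).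

Lemma next_inj m t : injective (@next m t).
Proof. by move=> [j i] [j' i'] [-> h]; congr (_, _); apply: (can_inj (@ordSK t)); apply: val_inj. Qed.

(** Only the entry closing the cycle of hyperedge [j] carries the sign [w j], so the signs along
    that cycle multiply to [(-1) ^+ w j]. *)
Definition edge_sign (R : pzRingType) (m t : nat) (w : {ffun 'I_m -> bool})
    (ji : 'I_m * 'I_t) : R := if ji.2.+1 == t then (-1) ^+ w ji.1 else 1.

Lemma edge_sign_sqr (R : pzRingType) (m t : nat) w (ji : 'I_m * 'I_t) :
  edge_sign R w ji ^+ 2 = 1.
Proof. by rewrite /edge_sign; case: ifP => _; rewrite ?sqrr_sign ?expr1n. Qed.

Definition gadget (R : pzRingType) (n m t : nat) (e : 'I_m * 'I_t -> 'I_n)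
    (x : {ffun 'I_n -> bool}) (w : {ffun 'I_m -> bool}) : 'M[R]_n :=
  \sum_v (-1) ^+ x v *: delta_mx v v +
  \sum_ji edge_sign R w ji *: delta_mx (e ji) (e (next ji)).

Lemma gadget_mulr (R : comPzRingType) n m t (e : 'I_m * 'I_t -> 'I_n)
    (x : {ffun 'I_n -> bool}) (w : {ffun 'I_m -> bool})
    (y : 'I_n -> R) r :
  \sum_c gadget R e x w r c * y c =
  (-1) ^+ x r * y r + \sum_(ji | e ji == r) edge_sign R w ji * y (e (next ji)).
Proof.
under eq_bigr do rewrite mxE mulrDl.
by rewrite big_split /= !delta_sum_mulr big_pred1_eq.
Qed.

Lemma gadget_mull (R : comPzRingType) n m t (e : 'I_m * 'I_t -> 'I_n)
    (x : {ffun 'I_n -> bool}) (w : {ffun 'I_m -> bool})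
    (y : 'I_n -> R) c :
  \sum_r y r * gadget R e x w r c =
  (-1) ^+ x c * y c + \sum_(ji | e (next ji) == c) edge_sign R w ji * y (e ji).
Proof.
under eq_bigr do rewrite mxE mulrDr.
by rewrite big_split /= !delta_sum_mull big_pred1_eq.
Qed.

(* [(a + b)^2 = 2 a^2 + 2 b^2 - (a - b)^2] on every row; the rows met by an edge
   are permuted by [next]. *)
Lemma gadget_norm (R : comPzRingType) n m t (e : 'I_m * 'I_t -> 'I_n)
    (x : {ffun 'I_n -> bool}) (w : {ffun 'I_m -> bool})
    (y : 'I_n -> R) : injective e ->
  \sum_r (\sum_c gadget R e x w r c * y c) ^+ 2 =
  4 * \sum_ji y (e ji) ^+ 2 + \sum_(r | r \notin codom e) y r ^+ 2
  - \sum_ji ((-1) ^+ x (e ji) * y (e ji) - edge_sign R w ji * y (e (next ji))) ^+ 2.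
Proof.
move=> e_inj; rewrite (big_codom _ e_inj) [RHS]addrAC; congr (_ + _); last first.
  apply: eq_bigr => r re; rewrite gadget_mulr big_pred0 => [|ji].
    by rewrite addr0 exprMn sqrr_sign mul1r.
  by apply/negbTE; apply: contraNneq re => <-; exact: codom_f.
have -> : 4 * \sum_ji y (e ji) ^+ 2 =
    \sum_ji (2 * y (e ji) ^+ 2 + 2 * y (e (next ji)) ^+ 2).
  rewrite big_split -!mulr_sumr /=.
  rewrite -(reindex_inj (@next_inj m t) (F := fun ji => y (e ji) ^+ 2) (P := predT)) /=.
  by rewrite -mulrDl -natrD.
rewrite -sumrB; apply: eq_bigr => ji _; rewrite gadget_mulr.
rewrite (big_pred1 ji) => [|k]; last by rewrite /= (inj_eq e_inj).
have := sqrr_sign R (x (e ji)); have := edge_sign_sqr R w ji.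
move: (y (e ji)) (y (e (next ji))) ((-1) ^+ x (e ji)) (edge_sign R w ji) => a b s u u1 s1.
have -> : 2 * a ^+ 2 + 2 * b ^+ 2 = 2 * (s ^+ 2 * a ^+ 2) + 2 * (u ^+ 2 * b ^+ 2).
  by rewrite u1 s1 !mul1r.
by ring.
Qed.

(** A gauge along the cycle: multiplying the [k]-th coordinate by it turns the signed differences of
    [gadget_norm] into plain ones. Positions are taken modulo [t.+1], so that [k = t.+1] is a full
    turn. *)
Definition prefix_sign (R : pzRingType) n m t (e : 'I_m * 'I_t.+1 -> 'I_n)
    (x : {ffun 'I_n -> bool}) (w : {ffun 'I_m -> bool}) (j : 'I_m) (k : nat) : R :=
  \prod_(i < k) ((-1) ^+ x (e (j, inZp i)) * edge_sign R w (j, inZp i : 'I_t.+1)).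

Lemma inZpS t k : @inZp t k.+1 = ordS (inZp k).
Proof. by apply: val_inj; rewrite /= -addn1 -modnDml addn1. Qed.

Lemma prefix_sign_sqr (R : comPzRingType) n m t (e : 'I_m * 'I_t.+1 -> 'I_n)
    (x : {ffun 'I_n -> bool}) (w : {ffun 'I_m -> bool}) j k :
  prefix_sign R e x w j k ^+ 2 = 1.
Proof.
rewrite /prefix_sign -prodrXl big1 // => i _.
by rewrite exprMn sqrr_sign edge_sign_sqr mulr1.
Qed.

Lemma prefix_signS (R : comPzRingType) n m t (e : 'I_m * 'I_t.+1 -> 'I_n)
    (x : {ffun 'I_n -> bool}) (w : {ffun 'I_m -> bool}) j k :
  prefix_sign R e x w j k.+1 =
  prefix_sign R e x w j k * ((-1) ^+ x (e (j, inZp k)) * edge_sign R w (j, inZp k : 'I_t.+1)).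
Proof. by rewrite /prefix_sign big_ord_recr. Qed.

(** The holonomy of the cycle: the only sign that the gauge cannot remove, equal to 1 exactly when
    [w j] is the parity of [x] on the hyperedge. *)
Lemma prefix_sign_full (R : comPzRingType) n m t (e : 'I_m * 'I_t.+1 -> 'I_n)
    (x : {ffun 'I_n -> bool}) (w : {ffun 'I_m -> bool}) j :
  prefix_sign R e x w j t.+1 =
  (-1) ^+ (\big[addb/false]_i x (e (j, i))) * (-1) ^+ w j.
Proof.
rewrite /prefix_sign.
under [LHS]eq_bigr do rewrite !valZpK.
rewrite big_split /=; congr (_ * _).
  by apply/esym/(big_morph (fun b : bool => (-1) ^+ b : R)) => //; exact: signr_addb.
rewrite (bigD1 ord_max) //= big1 ?mulr1 => [|i]; rewrite /edge_sign /=.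
  by rewrite eqxx.
rewrite eqSS -[_ == _]negbK => /negbTE h; case: eqP => // /(@val_inj _ _ _ i ord_max).
by move=> ei; rewrite ei eqxx in h.
Qed.

(** With trivial holonomy the gauge closes up, so its recursion also holds across the wrap-around
    from the last position. *)
Lemma prefix_sign_next (R : comPzRingType) n m t (e : 'I_m * 'I_t.+1 -> 'I_n)
    (x : {ffun 'I_n -> bool}) (w : {ffun 'I_m -> bool}) j i :
  prefix_sign R e x w j t.+1 = 1 ->
  prefix_sign R e x w j (ordS i) =
  (-1) ^+ x (e (j, i)) * edge_sign R w (j, i) * prefix_sign R e x w j i.
Proof.
move=> full; rewrite mulrC -[in RHS](valZpK i) /=.
have -> : (i %% t.+1 = i)%N by rewrite modn_small.
rewrite -prefix_signS.
have [->|it] := eqVneq i ord_max; first by rewrite /= modnn full /prefix_sign big_ord0.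
rewrite /= modn_small // ltnS ltn_neqAle -ltnS ltn_ord andbT.
by apply: contraNneq it => it; apply/eqP/val_inj.
Qed.

Lemma gadget_norm_odd (R : realFieldType) n m t (e : 'I_m * 'I_t.+1 -> 'I_n)
    (x : {ffun 'I_n -> bool}) (w : {ffun 'I_m -> bool})
    (y : 'I_n -> R) : injective e ->
  (forall j, \big[addb/false]_i x (e (j, i)) = ~~ w j) ->
  \sum_r (\sum_c gadget R e x w r c * y c) ^+ 2 <=
  (4 - (3 * t.+1%:R ^+ 2)^-1) * \sum_c y c ^+ 2.
Proof.
move=> e_inj odd; rewrite (gadget_norm _ _ _ e_inj) (big_codom _ e_inj).
set S := \sum_ji y (e ji) ^+ 2; set T := \sum_(r | _) _; set E := \sum_(ji : _) _.
have T0 : 0 <= T by apply: sumr_ge0 => *; exact: sqr_ge0.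
have t1 : 1 <= t.+1%:R ^+ 2 :> R by rewrite -natrX ler1n expn_gt0.
(* [S] is the matched mass, [T] the unmatched mass and [E] the defect. Unmatched coordinates have
   factor 1 only, so the gap has to be proved on the cycles alone. *)
suff SE : S <= 3 * t.+1%:R ^+ 2 * E.
  have t3 : 0 < 3 * t.+1%:R ^+ 2 :> R by lra.
  have h1 : S / (3 * t.+1%:R ^+ 2) <= E by rewrite ler_pdivrMr // mulrC.
  have h2 : (3 * t.+1%:R ^+ 2)^-1 <= 1 :> R by rewrite invf_le1 //; lra.
  have h3 : (3 * t.+1%:R ^+ 2)^-1 * T <= T by rewrite -[leRHS]mul1r ler_wpM2r.
  move: h1 h3; set c := (_ * _)^-1 => h1 h3.
  by rewrite mulrBl !mulrDr; lra.
have pairE (F : 'I_m * 'I_t.+1 -> R) : \sum_ji F ji = \sum_j \sum_i F (j, i).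
  by rewrite pair_big; apply: eq_bigr => -[].
rewrite /S /E !pairE mulr_sumr; apply: ler_sum => j _.
(* In the gauge the sequence is antiperiodic, its holonomy being -1, and [cycle_gap] applies. *)
pose z k := prefix_sign R e x w j k * y (e (j, inZp k)).
have zt : z t.+1 = - z 0%N.
  rewrite /z prefix_sign_full odd /prefix_sign big_ord0 mul1r.
  have -> : inZp t.+1 = inZp 0 :> 'I_t.+1 by apply: val_inj; rewrite /= modnn mod0n.
  by case: (w j); rewrite /= ?expr0 ?expr1 ?mulr1 ?mul1r ?mulN1r.
have -> : \sum_i y (e (j, i)) ^+ 2 = \sum_(k < t.+1) z k ^+ 2.
  by apply: eq_bigr => k _; rewrite /z exprMn prefix_sign_sqr mul1r valZpK.
apply: le_trans (cycle_gap zt) _; apply: ler_wpM2l; first by lra.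
apply: ler_sum => k _; rewrite le_eqVlt; apply/orP; left; apply/eqP.
rewrite /z prefix_signS inZpS !valZpK /next /=.
have := prefix_sign_sqr R e x w j k.
have := sqrr_sign R (x (e (j, k))); have := edge_sign_sqr R w (j, k).
move: (y _) (y _) ((-1) ^+ _) (edge_sign R w _) (prefix_sign _ _ _ _ _ _) => b a s u g u1 s1 g1.
transitivity (g ^+ 2 * (a ^+ 2 + s ^+ 2 * u ^+ 2 * b ^+ 2 - 2 * s * u * a * b)); first by ring.
rewrite g1 u1 s1 !mul1r.
transitivity (s ^+ 2 * a ^+ 2 + u ^+ 2 * b ^+ 2 - 2 * s * u * a * b); last by ring.
by rewrite u1 s1 !mul1r.
Qed.

Lemma gadget_norm_le (R : realFieldType) n m t (e : 'I_m * 'I_t -> 'I_n)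
    (x : {ffun 'I_n -> bool}) (w : {ffun 'I_m -> bool})
    (y : 'I_n -> R) : injective e ->
  \sum_r (\sum_c gadget R e x w r c * y c) ^+ 2 <= 4 * \sum_c y c ^+ 2.
Proof.
move=> e_inj; rewrite (gadget_norm _ _ _ e_inj) (big_codom (fun c => y c ^+ 2) e_inj).
set S := \sum_ji y (e ji) ^+ 2; set T := \sum_(r | _) _; set E := \sum_(ji : _) _.
have T0 : 0 <= T by apply: sumr_ge0 => *; exact: sqr_ge0.
have E0 : 0 <= E by apply: sumr_ge0 => *; exact: sqr_ge0.
by rewrite mulrDr; lra.
Qed.

(** With trivial holonomy on each cycle, the gauge itself, supported on one hyperedge, is a right
    singular vector of value 2; the [m] disjoint supports make these vectors independent. *)
Lemma gadget_mup (R : realFieldType) n m t (e : 'I_m * 'I_t.+1 -> 'I_n)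
    (x : {ffun 'I_n -> bool}) (w : {ffun 'I_m -> bool}) :
  injective e -> (forall j, \big[addb/false]_i x (e (j, i)) = w j) ->
  ('X - 4%:P) ^+ m %| char_poly ((gadget R e x w)^T *m gadget R e x w).
Proof.
move=> e_inj even; pose A := gadget R e x w.
pose g (ji : 'I_m * 'I_t.+1) : R := prefix_sign R e x w ji.1 ji.2.
have g_next ji : g (next ji) = (-1) ^+ x (e ji) * edge_sign R w ji * g ji.
  case: ji => j i; rewrite /g /= prefix_sign_next // prefix_sign_full even.
  by rewrite -expr2 sqrr_sign.
pose V : 'M[R]_(m, n) := \matrix_(j, c) \sum_(ji | e ji == c) (if ji.1 == j then g ji else 0).
have Ve j ji : V j (e ji) = if ji.1 == j then g ji else 0.
  rewrite mxE (big_pred1 ji) // => k; by rewrite /= (inj_eq e_inj).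
have V0 j c : c \notin codom e -> V j c = 0.
  move=> ce; rewrite mxE big_pred0 // => ji.
  by apply/negbTE; apply: contraNneq ce => <-; exact: codom_f.
have off (c : 'I_n) (f : 'I_m * 'I_t.+1 -> R) : c \notin codom e ->
    \sum_(ji | e ji == c) f ji = 0.
  move=> ce; rewrite big_pred0 // => ji.
  by apply/negbTE; apply: contraNneq ce => <-; exact: codom_f.
(* With [v] a row of [V] and [x] acting by diagonal signs [s]: [A v = 2 s v], and in [step2]
   [A^T (s v) = 2 v]. *)
have step1 j r : \sum_c A r c * V j c = 2 * ((-1) ^+ x r * V j r).
  rewrite gadget_mulr; have [/codomP [ji ->]|re] := boolP (r \in codom e).
    rewrite (big_pred1 ji) => [|k]; last by rewrite /= (inj_eq e_inj).
    rewrite !Ve /= g_next; case: ifP => _; last by rewrite !mulr0 addr0.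
    have u1 := edge_sign_sqr R w ji.
    transitivity ((-1) ^+ x (e ji) * g ji +
      edge_sign R w ji ^+ 2 * ((-1) ^+ x (e ji) * g ji)); first by ring.
    by rewrite u1; ring.
  by rewrite off // V0 // !mulr0 addr0.
have step2 j c : \sum_r ((-1) ^+ x r * V j r) * A r c = 2 * V j c.
  rewrite (gadget_mull e x w (fun r => (-1) ^+ x r * V j r)) mulrA -expr2 sqrr_sign mul1r.
  have [/codomP [ji ->]|ce] := boolP (c \in codom e).
    have [ji' ->] : exists ji', ji = next ji'.
      by have [k _ kK] := injF_bij (@next_inj m t.+1); exists (k ji); rewrite kK.
    rewrite (big_pred1 ji') => [|k]; last first.
      by rewrite /= (inj_eq e_inj) (inj_eq (@next_inj m t.+1)).
    rewrite !Ve /= g_next; case: ifP => _; last by rewrite !mulr0 addr0.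
    by ring.
  rewrite V0 // mulr0 big_pred0 ?addr0 // => ji.
  by apply/negbTE; apply: contraNneq ce => <-; exact: codom_f.
have VA : V *m (A^T *m A) = 4 *: V.
  rewrite mulmxA; apply/matrixP => j c; rewrite [LHS]mxE [RHS]mxE.
  rewrite (_ : 4 = 2 * 2); last by rewrite -natrM.
  rewrite -mulrA -step2 mulr_sumr; apply: eq_bigr => r _.
  rewrite [X in X * _]mxE mulrA; congr (_ * _); rewrite -step1.
  by apply: eq_bigr => k _; rewrite !mxE // mulrC.
apply: dvdp_char_poly VA.
(* The rows of [V] are orthogonal with squared norm [t.+1]. *)
apply/row_freeP; exists (t.+1%:R^-1 *: V^T); rewrite -scalemxAr.
apply/matrixP => j j'; rewrite !mxE.
under eq_bigr do rewrite [V^T _ _]mxE.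
rewrite (big_codom (fun c => V j c * V j' c) e_inj) [X in _ + X]big1 => [|c ce]; last first.
  by rewrite V0 // mul0r.
rewrite addr0.
have -> : \sum_ji V j (e ji) * V j' (e ji) = \sum_j0 \sum_(i < t.+1) ((j0 == j) && (j0 == j'))%:R.
  rewrite pair_big; apply: eq_bigr => -[j0 i] _ /=; rewrite !Ve /=.
  by do 2!case: eqP => _ //=; rewrite ?mulr0 ?mul0r // -expr2 prefix_sign_sqr.
rewrite (bigD1 j) //= eqxx /= sumr_const card_ord big1 => [|j0 /negbTE ->]; last first.
  by rewrite big1.
by rewrite addr0 -[X in _ * X]mulr_natl mulrA mulVf ?mul1r ?pnatr_eq0.
Qed.

(** * Singular values *)

From mathcomp Require Import all_classical all_reals all_analysis.
From mathcomp Require Import measurable_realfun.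

Lemma singular_value_le (R : realType) (n : nat) (A : 'M[R]_n) (b : R) i :
  (forall lambda, root (char_poly (A^T *m A)) lambda -> lambda <= b) ->
  0 <= nth 0 (singular_values A) i <= Num.sqrt b.
Proof.
(* Past the end of the list [nth] returns the default 0, which lies within the bounds. *)
move=> hb; have [si|si] := leqP (size (singular_values A)) i.
  by rewrite nth_default // lexx sqrtr_ge0.
have := mem_nth 0 si; rewrite /singular_values mem_rev => /mapP [l lr ->].
rewrite sqrtr_ge0 ler_wsqrtr // hb //.
move: lr => /flattenP [s /mapP [y yr ->]] /nseqP [-> _].
by move: yr; rewrite -roots_on_rootsR ?monic_neq0 ?char_poly_monic //= => ->.
Qed.

(** Roots are listed in increasing order and [a] is the largest, so after [rev] the list starts with
    its [mup a p >= m] copies. *)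
Lemma singular_value_top (R : realType) (n : nat) (A : 'M[R]_n) (a : R) m i :
  (forall lambda, root (char_poly (A^T *m A)) lambda -> lambda <= a) ->
  ('X - a%:P) ^+ m %| char_poly (A^T *m A) -> (i < m)%N ->
  nth 0 (singular_values A) i = Num.sqrt a.
Proof.
set p := char_poly _ => ha hdvd im.
have p0 : p != 0 by rewrite monic_neq0 ?char_poly_monic.
have am : (m <= mup a p)%N by rewrite mup_geq.
have root_a : root p a.
  by rewrite -dvdp_XsubCl; apply: dvdp_trans hdvd; rewrite dvdp_exp //; lia.
have memE y : (y \in rootsR p) = root p y by rewrite -roots_on_rootsR.
have : sorted <%R (rootsR p) by exact: sorted_roots.
case/lastP rE : (rootsR p) => [|s b] srt.
  by have := memE a; rewrite rE root_a.
have ba : b = a.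
  apply/le_anti; rewrite ha /=; last by rewrite -memE rE mem_rcons mem_head.
  have : a \in rcons s b by rewrite -rE memE.
  rewrite mem_rcons inE => /predU1P [->//|as_].
  rewrite ltW //; move: srt; rewrite -cats1 (sorted_pairwise lt_trans) pairwise_cat.
  by case/andP => /allrelP /(_ a b as_) h _; apply: h; rewrite mem_head.
rewrite /singular_values -/p /real_roots rE ba map_rcons flatten_rcons map_cat rev_cat.
rewrite map_nseq rev_nseq nth_cat size_nseq (leq_trans im am) nth_nseq.
by rewrite (leq_trans im am).
Qed.

(** * Streams *)

Definition diag_stream (R : realType) (n : nat) (x : {ffun 'I_n -> bool}) :
    seq (update R n) :=
  [seq (v, v, (-1) ^+ x v) | v <- enum 'I_n].

Definition edge_stream (R : realType) (n m t : nat) (e : 'I_m * 'I_t -> 'I_n)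
    (w : {ffun 'I_m -> bool}) : seq (update R n) :=
  [seq (e ji, e (next ji), edge_sign R w ji) | ji <- enum {: 'I_m * 'I_t}].

Definition gadget_stream (R : realType) (n m t : nat) (e : 'I_m * 'I_t -> 'I_n)
    (x : {ffun 'I_n -> bool}) (w : {ffun 'I_m -> bool}) : seq (update R n) :=
  diag_stream R x ++ edge_stream R e w.

Lemma gadget_streamE (R : realType) n m t (e : 'I_m * 'I_t -> 'I_n) x w :
  stream_matrix (gadget_stream R e x w) = gadget R e x w.
Proof.
rewrite /stream_matrix big_cat /gadget; congr (_ + _).
  by rewrite big_map big_enum.
by rewrite big_map big_enum.
Qed.

Lemma size_diag_stream (R : realType) n (x : {ffun 'I_n -> bool}) :
  size (diag_stream R x) = n.
Proof. by rewrite size_map size_enum_ord. Qed.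

Lemma size_edge_stream (R : realType) n m t (e : 'I_m * 'I_t -> 'I_n) w :
  size (edge_stream R e w) = (m * t)%N.
Proof. by rewrite size_map -cardE card_prod !card_ord. Qed.

Lemma poly_bounded_gadget (R : realType) n m t (e : 'I_m * 'I_t -> 'I_n) x w d :
  (1 < n)%N -> (1 < d)%N -> (m * t <= n)%N -> poly_bounded d (gadget_stream R e x w).
Proof.
move=> n1 d1 mt; have nd : (n + n <= n ^ d)%N.
  apply: (@leq_trans (n ^ 2)); last by rewrite leq_exp2l.
  by rewrite addnn -mul2n expnS expn1 leq_mul2r n1 orbT.
split.
  by rewrite size_cat size_diag_stream size_edge_stream (leq_trans _ nd) ?leq_add2l.
have sgn (b : bool) : ((-1) ^+ b : R) \is a Num.int /\ `|(-1) ^+ b : R| <= (n ^ d)%:R.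
  split; first by rewrite rpredX // rpredN1.
  by rewrite normrX normrN1 expr1n ler1n; lia.
move=> u; rewrite mem_cat => /orP[/mapP [v _ ->]|/mapP [ji _ ->]] /=; first exact: sgn.
rewrite /edge_sign; case: ifP => _; first exact: sgn.
exact: (sgn false).
Qed.

Lemma nnz_gadget (R : realType) n m t (e : 'I_m * 'I_t -> 'I_n) x w :
  (m * t <= n)%N -> (nnz (gadget R e x w) <= 2 * n)%N.
Proof.
move=> mt; pose D := [set (v, v) | v : 'I_n].
pose E := [set (e ji, e (next ji)) | ji : 'I_m * 'I_t].
apply: (@leq_trans #|D :|: E|).
  apply: subset_leq_card; apply/fintype.subsetP => -[r c]; rewrite !inE /=.
  apply: contraR; rewrite negb_or => /andP[rD rE]; rewrite mxE !summxE.
  have dv v : ((-1) ^+ x v *: delta_mx v v : 'M[R]_n) r c = 0.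
    rewrite !mxE; case: eqP => [rv|]; rewrite ?mulr0 //.
    case: eqP => [cv|]; rewrite ?mulr0 //.
    by case/negP: rD; rewrite rv cv; apply/imsetP; exists v.
  have de ji : (edge_sign R w ji *: delta_mx (e ji) (e (next ji)) : 'M[R]_n) r c = 0.
    rewrite !mxE; case: eqP => [re|]; rewrite ?mulr0 //.
    case: eqP => [ce|]; rewrite ?mulr0 //.
    by case/negP: rE; rewrite re ce; apply/imsetP; exists ji.
  by rewrite !big1 ?addr0.
rewrite cardsU; apply: leq_trans (leq_subr _ _) _.
apply: (@leq_trans (n + m * t)); last by lia.
apply: leq_add.
  by apply: leq_trans (leq_imset_card _ _) _; rewrite card_ord.
by apply: leq_trans (leq_imset_card _ _) _; rewrite card_prod !card_ord.
Qed.

(** The run is restarted with the counter at [k], because [step] sees the number of updates already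
    read. *)
Definition resume (R : realType) (n : nat) (alg : streaming_algorithm R n)
    (w : tape alg) (k : nat) (mem : (bits alg).-tuple bool) (s : seq (update R n)) :
    (bits alg).-tuple bool :=
  (foldl (fun tm u => (tm.1.+1, step w tm.1 tm.2 u)) (k, mem) s).2.

Lemma memory_after_cat (R : realType) (n : nat) (alg : streaming_algorithm R n)
    (w : tape alg) (s s' : seq (update R n)) :
  memory_after w (s ++ s') = resume w (size s) (memory_after w s) s'.
Proof.
rewrite /memory_after /resume foldl_cat; set st := foldl _ _ s.
suff <- : st.1 = size s by rewrite -surjective_pairing.
rewrite /st -[RHS]add0n; move: 0%N (start w).
by elim: s {st} => [|u s IH] k mem /=; rewrite ?addn0 // IH addSnnS.
Qed.

(** Averaging over the tape: a bound on the number of events occurring, valid for every tape, is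
    integrated. *)
Lemma sum_probability_le (R : realType) (d : measure_display) (T : measurableType d)
    (P : probability T R) (I : finType) (G : I -> set T) (c : R) :
  (forall i, measurable (G i)) -> (forall w, \sum_i \1_(G i) w <= c) ->
  (\sum_i P (G i) <= c%:E)%E.
Proof.
move=> mG hc.
have mI i : measurable_fun setT (fun w => (\1_(G i) w)%:E : \bar R).
  by apply/measurable_EFinP; exact: measurable_indic.
have -> : (\sum_i P (G i))%E = (\int[P]_w (\sum_i (\1_(G i) w)%:E))%E.
  rewrite ge0_integral_sum //.
  by apply: eq_bigr => i _; rewrite integral_indic // setIT.
have -> : c%:E = (\int[P]_w (cst c%:E) w)%E.
  by rewrite integral_cst //= probability_setT mule1.
apply: ge0_le_integral => //.
- by move=> w _; apply: sume_ge0 => i _; rewrite lee_fin.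
- by apply: emeasurable_sum.
- by move=> w _ /=; rewrite sumEFin lee_fin.
Qed.

(* Alice holds the diagonal signs [x], Bob the matching [s] and the signs [w] of
   its closing edges; the bits stored between the two halves of the stream are
   Alice's message. *)
Lemma streaming_advantage (R : realType) (n m t : nat) (slot : 'I_m * 'I_t -> 'I_n)
    (alg : streaming_algorithm R n) (adm : seq (update R n) -> Prop)
    (Q : 'M[R]_n -> R) (eps p q beta : R) :
  approximates_on alg adm Q eps p ->
  (forall (s : {perm 'I_n}) x w, adm (gadget_stream R (s \o slot) x w)) ->
  (forall (s : {perm 'I_n}) x,
     Q (gadget R (s \o slot) x (edge_parity slot s x)) = q) ->
  (forall (s : {perm 'I_n}) x y,
     approximates eps y (Q (gadget R (s \o slot) x (negv (edge_parity slot s x)))) ->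
     ~ approximates eps y q) ->
  (forall (enc : {ffun 'I_n -> bool} -> (bits alg).-tuple bool)
     (D : (bits alg).-tuple bool -> {perm 'I_n} -> {ffun 'I_m -> bool} -> bool),
     \sum_(s : {perm 'I_n}) \sum_x ((D (enc x) s (edge_parity slot s x))%:R -
        (D (enc x) s (negv (edge_parity slot s x)))%:R) <=
     (n`!)%:R * (2 ^ n)%:R * beta) ->
  2 * p <= 1 + beta.
Proof.
move=> alg_ok adm_ok Qeven Qodd hadv.
pose I := ({perm 'I_n} * {ffun 'I_n -> bool})%type.
pose str (b : bool) (i : I) := gadget_stream R (i.1 \o slot) i.2
  (if b then edge_parity slot i.1 i.2 else negv (edge_parity slot i.1 i.2)).
pose G (bi : bool * I) := [set w : tape alg |
  approximates eps (output w (str bi.1 bi.2)) (Q (stream_matrix (str bi.1 bi.2)))]%classic.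
have G_ok bi : measurable (G bi) /\ (p%:E <= law alg (G bi))%E.
  by apply: alg_ok; apply: adm_ok.
pose N : R := (n`!)%:R * (2 ^ n)%:R.
have N0 : 0 < N by rewrite mulr_gt0 // ltr0n ?fact_gt0 ?expn_gt0.
have cI : #|{: I}|%:R = N by rewrite card_prod card_all_perms card_ffun card_bool !card_ord natrM.
(* For a fixed tape the algorithm is a deterministic one-way protocol. The test [D] accepts when the
   output approximates [q]: a correct run on the parity vector is accepted and a correct run on its
   complement is rejected, so the number of correct runs exceeds [N] by at most the advantage. *)
have pw (w : tape alg) : \sum_bi \1_(G bi) w <= N * (1 + beta).
  pose D z (s : {perm 'I_n}) (v : {ffun 'I_m -> bool}) := `[< approximates eps
    (estimate w (n + m * t) (resume w n z (edge_stream R (s \o slot) v))) q >].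
  pose enc x := memory_after w (diag_stream R x).
  have outE b i : output w (str b i) = estimate w (n + m * t)
      (resume w n (enc i.2) (edge_stream R (i.1 \o slot)
        (if b then edge_parity slot i.1 i.2 else negv (edge_parity slot i.1 i.2)))).
    by rewrite /output /str size_cat memory_after_cat size_diag_stream size_edge_stream.
  have even i : \1_(G (true, i)) w <= (D (enc i.2) i.1 (edge_parity slot i.1 i.2))%:R :> R.
    rewrite indicE ler_nat; case: (boolP (_ \in _)) => // /set_mem.
    rewrite /G /= outE /= /str gadget_streamE /= Qeven => h.
    by rewrite /D asboolT.
  have odd i : \1_(G (false, i)) w <=
      1 - (D (enc i.2) i.1 (negv (edge_parity slot i.1 i.2)))%:R :> R.
    rewrite indicE; case: (boolP (_ \in _)) => [/set_mem|_]; last first.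
      by case: (D _ _ _); rewrite ?subrr ?subr0.
    rewrite /G /= outE /= /str gadget_streamE /= => /Qodd h.
    by rewrite /D asboolF // subr0.
  have -> : \sum_bi \1_(G bi) w = \sum_i (\1_(G (true, i)) w + \1_(G (false, i)) w) :> R.
    rewrite big_split /=.
    rewrite (eq_bigr (fun bi => \1_(G (bi.1, bi.2)) w)) => [|[]//].
    by rewrite -(pair_bigA _ (fun b i => \1_(G (b, i)) w)) /= big_bool.
  apply: (@le_trans _ _ (\sum_(i : I) (1 +
     ((D (enc i.2) i.1 (edge_parity slot i.1 i.2))%:R -
      (D (enc i.2) i.1 (negv (edge_parity slot i.1 i.2)))%:R)))).
    by apply: ler_sum => i _; have := lerD (even i) (odd i); lra.
  rewrite big_split /= sumr_const cI mulrDr mulr1 lerD2l.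
  by rewrite -(pair_bigA _ (fun s x => (D (enc x) s (edge_parity slot s x))%:R -
     (D (enc x) s (negv (edge_parity slot s x)))%:R)) /=; exact: hadv.
have := sum_probability_le (law alg) (fun bi => (G_ok bi).1) pw.
have : (\sum_(bi : bool * I) p%:E <= \sum_bi law alg (G bi))%E.
  by apply: lee_sum => bi _; exact: (G_ok bi).2.
move=> /le_trans h /h; rewrite sumEFin lee_fin sumr_const card_prod card_bool.
rewrite -(mulr_natl p) natrM cI (mulrC 2) -mulrA ler_pM2l //.
Qed.

(** * Separation of the two values and elementary choices *)

Lemma ler_norm_monotone (R : realType) (f : R -> R) x y :
  strictly_monotone_nneg f -> f 0 = 0 -> 0 <= x -> x < y -> `|f x| < `|f y|.
Proof.
move=> [inc|dec] f0 x0 xy.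
- have fx : 0 <= f x.
    by move: x0; rewrite le_eqVlt => /predU1P [<-|/(inc _ _ (lexx _))]; rewrite f0 // => /ltW.
  by rewrite !ger0_norm ?inc // (le_trans fx) // ltW // inc.
have fx : f x <= 0.
  by move: x0; rewrite le_eqVlt => /predU1P [<-|/(dec _ _ (lexx _))]; rewrite f0 // => /ltW.
have fxy := dec _ _ x0 xy.
by rewrite !ler0_norm ?ltrN2 // (le_trans (ltW fxy)).
Qed.

Lemma exists_separating_eps (R : realFieldType) (a b : R) : 0 <= a -> a < b ->
  exists2 eps, 0 < eps & forall (k : nat) (y q1 q2 : R), (0 < k)%N ->
    `|q1| = k%:R * b -> `|q2| <= k%:R * a ->
    `|y - q2| <= eps * `|q2| -> ~ `|y - q1| <= eps * `|q1|.
Proof.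
(* Chosen so that [eps * (a + b)] is half the gap [b - a]: the two error intervals then cannot meet,
   whatever the common factor [k]. *)
move=> a0 ab; pose eps := (b - a) / (2 * (a + b)).
have ab0 : 0 < a + b by lra.
have eps0 : 0 < eps by rewrite divr_gt0 ?subr_gt0 // mulr_gt0.
exists eps => // k y q1 q2 k0 h1 h2 h3 h4.
have kR : 0 < k%:R :> R by rewrite ltr0n.
have e : eps * (a + b) = (b - a) / 2.
  by rewrite /eps invfM mulrA divfK // gt_eqF.
have tri : `|q1| <= `|y - q1| + `|y - q2| + `|q2|.
  have {1}-> : q1 = - (y - q1) + (y - q2) + q2 by ring.
  apply: le_trans (ler_normD _ _) _; rewrite lerD2r.
  by apply: le_trans (ler_normD _ _) _; rewrite normrN.
have h5 : eps * `|q2| <= eps * (k%:R * a) by rewrite ler_pM2l.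
have : k%:R * b <= eps * (k%:R * b) + eps * (k%:R * a) + k%:R * a.
  move: h4 tri; rewrite h1 => h4 /le_trans; apply.
  exact: lerD (lerD h4 (le_trans h3 h5)) h2.
have -> : eps * (k%:R * b) + eps * (k%:R * a) + k%:R * a =
   k%:R * (eps * (a + b) + a) by ring.
by rewrite ler_pM2l // e; lra.
Qed.

Lemma exists_small_expr (R : archiRealFieldType) (r c : R) : 0 <= r -> r < 1 -> 0 < c ->
  exists2 k : nat, (0 < k)%N & forall j, (k <= j)%N -> r ^+ j <= c.
Proof.
move=> r0 r1 c0.
(* Bernoulli's inequality in multiplied-out form, giving an explicit decay rate without
   logarithms. *)
have bern k : r ^+ k * (1 + k%:R * (1 - r)) <= 1.
  elim: k => [|k IH]; first by rewrite expr0 mul0r addr0 mulr1.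
  apply: le_trans IH; rewrite exprS (mulrC r) -mulrA.
  apply: ler_wpM2l; first by rewrite exprn_ge0.
  have h : 0 <= k%:R * (1 - r) ^+ 2 by rewrite mulr_ge0 ?sqr_ge0.
  rewrite -subr_ge0 -natr1.
  have -> : 1 + k%:R * (1 - r) - r * (1 + (k%:R + 1) * (1 - r)) =
    k%:R * (1 - r) ^+ 2 + (1 - r) ^+ 2 by ring.
  by rewrite addr_ge0 ?sqr_ge0.
pose k := (Num.truncn (c^-1 / (1 - r))).+1.
exists k => // j kj; have rj : r ^+ j <= r ^+ k by apply: ler_wiXn2l => //; exact: ltW.
apply: (le_trans rj); have := bern k.
have kc : c^-1 <= k%:R * (1 - r).
  by rewrite -ler_pdivrMr ?subr_gt0 // ltW // truncnS_gt.
rewrite -ler_pdivlMr; last by apply: lt_le_trans ltr01 _; rewrite lerDl mulr_ge0 ?subr_ge0 // ltW.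
move=> /le_trans; apply; rewrite mul1r -[leRHS]invrK lef_pV2 ?posrE ?invr_gt0 //.
  by rewrite (le_trans kc) // lerDr.
by apply: lt_le_trans ltr01 _; rewrite lerDl mulr_ge0 ?subr_ge0 // ltW.
Qed.

Lemma exists_slot (m t n : nat) : (m * t <= n)%N ->
  exists slot : 'I_m * 'I_t -> 'I_n, injective slot.
Proof.
move=> mt; have h : (#|{: 'I_m * 'I_t}| <= n)%N by rewrite card_prod !card_ord.
exists (fun ji => widen_ord h (enum_rank ji)) => a b /(congr1 val) /= /val_inj.
exact: enum_rank_inj.
Qed.

(** The least [t] with [1 <= t.+1 * alpha]: minimality gives [t * alpha < 1], and [alpha < 1/2]
    excludes [t <= 1]. *)
Lemma exists_edge_size (R : archiRealFieldType) (alpha : R) : 0 < alpha -> alpha < 2^-1 ->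
  exists2 t : nat, (1 < t)%N & (t%:R * alpha < 1) /\ 1 <= t.+1%:R * alpha.
Proof.
move=> a0 a2.
have ex : exists N, 1 <= N.+1%:R * alpha.
  exists (Num.truncn alpha^-1); rewrite -ler_pdivrMr // mul1r ltW //.
  exact: truncnS_gt.
case: (ex_minnP ex) => t ht tmin; exists t; last first.
  split=> //; case: t ht tmin => [|t] ht tmin; first by rewrite mul0r ltr01.
  by rewrite ltNge; apply/negP => /tmin; rewrite ltnn.
rewrite ltnNge; apply/negP => t1; move: ht; apply/negP; rewrite -ltNge.
apply: (@le_lt_trans _ _ (2 * alpha)); last by lra.
by apply: ler_wpM2r; [exact: ltW | rewrite ler_nat].
Qed.

Lemma top_spectral_sum_even (R : realType) (f : R -> R) n m t k
    (e : 'I_m * 'I_t.+1 -> 'I_n)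
    (x : {ffun 'I_n -> bool}) (w : {ffun 'I_m -> bool}) : injective e -> (k <= m)%N ->
  (forall j, \big[addb/false]_i x (e (j, i)) = w j) ->
  top_spectral_sum f k (gadget R e x w) = k%:R * f 2.
Proof.
move=> e_inj km even; rewrite /top_spectral_sum.
rewrite (eq_bigr (fun=> f 2)) ?sumr_const ?card_ord ?mulr_natl // => i _.
rewrite (@singular_value_top _ _ _ 4 m) //.
- by congr f; rewrite (_ : 4 = 2 ^+ 2) ?sqrtr_sqr ?ger0_norm // -natrX.
- move=> l; apply: gram_eigenvalue_le => v.
  exact: (gadget_norm_le x w (fun c => v 0 c) e_inj).
- exact: gadget_mup.
- exact: leq_trans (ltn_ord i) km.
Qed.

Lemma top_spectral_sum_odd (R : realType) (f : R -> R) n m t k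
    (e : 'I_m * 'I_t.+1 -> 'I_n)
    (x : {ffun 'I_n -> bool}) (w : {ffun 'I_m -> bool}) :
  strictly_monotone_nneg f -> f 0 = 0 -> injective e ->
  (forall j, \big[addb/false]_i x (e (j, i)) = ~~ w j) ->
  `|top_spectral_sum f k (gadget R e x w)| <=
    k%:R * `|f (Num.sqrt (4 - (3 * t.+1%:R ^+ 2)^-1))|.
Proof.
move=> f_mono f0 e_inj odd; apply: (le_trans (ler_norm_sum _ _ _)).
set tau := Num.sqrt _.
rewrite mulr_natl -[X in _ *+ X]card_ord -sumr_const; apply: ler_sum => i _.
have /andP [s0] : 0 <= nth 0 (singular_values (gadget R e x w)) i <= tau.
  apply: singular_value_le => l; apply: gram_eigenvalue_le => v.
  exact: (gadget_norm_odd (fun c => v 0 c) e_inj odd).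
rewrite le_eqVlt => /predU1P [->//|st].
by rewrite ltW // ler_norm_monotone.
Qed.

(** * Choice of the parameters *)

Lemma powR_root_expr (R : realType) (n t : nat) : (0 < t)%N ->
  ((n%:R : R) `^ (1 - t%:R^-1)) ^+ t = n%:R ^+ t.-1.
Proof.
move=> t0; rewrite -powR_mulrn ?powR_ge0 // -powRrM -powR_mulrn //.
congr (_ `^ _); rewrite mulrBl mul1r mulVf ?pnatr_eq0 -?lt0n //.
by rewrite -{1}(prednK t0) -natr1 addrK.
Qed.

Lemma powR_ge_large (R : realType) (X c : R) : 0 <= X -> 2^-1 <= c ->
  exists n0 : nat, forall n : nat, (n0 <= n)%N -> X <= (n%:R : R) `^ c.
Proof.
move=> X0 hc; exists (Num.truncn (X ^+ 2)).+1 => n hn.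
have nX : X ^+ 2 <= n%:R.
  by apply: ltW; apply: lt_le_trans (truncnS_gt _) _; rewrite ler_nat.
have n1 : 1 <= n%:R :> R by rewrite ler1n; apply: leq_trans hn.
apply: (@le_trans _ _ (n%:R `^ 2^-1)); last by apply: ler_powR.
by rewrite powR12_sqrt // -[leLHS](ger0_norm X0) -sqrtr_sqr ler_wsqrtr.
Qed.

(** With [L = ln alpha^-1] the exponent is [1 - c / L]. The second term of the maximum gives
    [c / L >= 1 / t]; the first keeps [c] above an absolute constant; both are below [L], so the
    exponent is positive. The bound [c <= 2] comes from [L <= alpha^-1 <= t + 1 <= 2 t]. *)
Lemma exponent_bounds (R : realType) (alpha : R) (t : nat) :
  0 < alpha -> alpha < 2^-1 -> (1 < t)%N -> 1 <= t.+1%:R * alpha ->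
  let c := Num.max (ln 2 / 2) (ln alpha^-1 / t%:R) in
  [/\ ln 2 / 2 <= c, c <= 2, 0 < 1 + c / ln alpha & 1 + c / ln alpha <= 1 - t%:R^-1].
Proof.
move=> a0 a2 t1 ta c.
have t0 : 0 < t%:R :> R by rewrite ltr0n; lia.
have ai : 2 < alpha^-1 by rewrite -[ltLHS]invrK ltf_pV2 ?posrE ?invr_gt0.
have L2 : ln 2 < ln alpha^-1 by rewrite ltr_ln ?posrE ?invr_gt0.
have ln20 : 0 < ln 2 :> R by rewrite ln_gt0 // ltr1n.
set L := ln alpha^-1 in L2 c *.
have L0 : 0 < L := lt_trans ln20 L2.
have lna : ln alpha = - L by rewrite /L lnV ?posrE // opprK.
have cL : c < L.
  rewrite /c gt_max; apply/andP; split; first by lra.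
  by rewrite ltr_pdivrMr // ltr_pMr // ltr1n.
have e : c / ln alpha = - (c / L) by rewrite lna invrN mulrN.
split.
- by rewrite /c le_max lexx.
- rewrite /c ge_max; apply/andP; split.
    by have := ln_sublinear (ltr0Sn R 1); lra.
  rewrite ler_pdivrMr //; apply: (@le_trans _ _ alpha^-1).
    by rewrite ltW // ln_sublinear // invr_gt0.
  rewrite -[leLHS]mul1r ler_pdivrMr // (le_trans ta) // ler_pM2r //.
  by rewrite -natrM ler_nat; lia.
- by rewrite e subr_gt0 ltr_pdivrMr // mul1r.
rewrite e lerD2l lerN2 ler_pdivlMr // mulrC.
by rewrite /c le_max lexx orbT.
Qed.

(* Chooses the bound [b] on the log-density of a class of inputs, above the number
   of stored bits but small enough for [hypermatching_advantage_le]. *)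
Lemma exists_log_density (R : realType) (t kappa : nat) (r delta E : R) (s : nat) :
  (1 < t)%N -> 0 < r -> r < 1 -> 0 < delta -> delta <= 1 -> E <= 1 - t%:R^-1 ->
  exists n0 : nat, forall n bts : nat, (n0 <= n)%N ->
    bts%:R < delta ^+ 2 / (512 * t%:R * kappa.+1%:R) * n%:R `^ E ->
  exists2 b : nat, (bts + s <= b)%N &
    let theta := (4 * kappa.+1 * b)%:R ^+ t / (n %/ t)%:R ^+ t.-1 : R in
    theta <= 2^-1 /\ 4 * (2 * theta + 2^-1 ^+ b / (1 - r)) <= delta ^+ 2.
Proof.
move=> t1 r0 r1 d0 d1 hE.
have t0 : (0 < t)%N by lia.
have tR : 0 < t%:R :> R by rewrite ltr0n.
have kR : 0 < kappa.+1%:R :> R by rewrite ltr0n.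
have d2 : 0 < delta ^+ 2 by rewrite exprn_gt0.
have d21 : delta ^+ 2 <= 1 by rewrite expr_le1 // ltW.
have ir : 0 < 1 - r by rewrite subr_gt0.
have [b0 _ hb0] := @exists_small_expr R 2^-1 (delta ^+ 2 * (1 - r) / 8)
  ltac:(lra) ltac:(lra) ltac:(by rewrite divr_gt0 ?mulr_gt0).
(* Chosen so that [4 * kappa.+1 * g = delta ^+ 2 / (32 * t)]. The constant 512 is four times 128,
   which leaves room between [bts] and [b] for [b0 + s]. *)
pose g := delta ^+ 2 / (128 * t%:R * kappa.+1%:R).
have g0 : 0 < g by rewrite divr_gt0 ?mulr_gt0.
have E2 : 2^-1 <= 1 - t%:R^-1 :> R.
  have : t%:R^-1 <= 2^-1 :> R by rewrite lef_pV2 ?posrE // ler_nat.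
  by lra.
pose X := (b0 + s + 2)%:R * 2 / g.
have [n1 hn1] := @powR_ge_large R X _ ltac:(by rewrite divr_ge0 ?mulr_ge0 // ltW) E2.
exists (maxn n1 (2 * t)) => n bts; rewrite geq_max => /andP[/hn1 hX nt] hb.
set P := n%:R `^ (1 - t%:R^-1) in hX.
have n_ge1 : 1 <= n%:R :> R by rewrite ler1n; move: nt t0; clear; lia.
have EP : n%:R `^ E <= P by rewrite /P ler_powR.
have gX : (b0 + s + 2)%:R * 2 <= g * P by rewrite (mulrC g) -ler_pdivrMr.
have hbP : bts%:R < g / 4 * P.
  apply: (lt_le_trans hb).
  have -> : delta ^+ 2 / (512 * t%:R * kappa.+1%:R) = g / 4.
    by rewrite /g; field; rewrite !gt_eqF.
  by apply: ler_wpM2l => //; rewrite divr_ge0 // ltW.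
have P0 : 0 <= P by exact: powR_ge0.
have gP0 : 0 <= g * P by rewrite mulr_ge0 // ltW.
pose b := Num.truncn (g * P).
have bP : b%:R <= g * P by rewrite truncn_le.
have Pb : g * P < b%:R + 1 by rewrite natr1 truncnS_gt.
have lbR : bts%:R + (b0 + s)%:R <= b%:R :> R.
  move: gX hbP Pb (ler0n R (b0 + s)); rewrite natrD (mulrAC g).
  by move: (g * P) ((b0 + s)%:R) (b%:R) (bts%:R) => u v w z; clear; lra.
have lb : (bts + (b0 + s) <= b)%N by rewrite -(ler_nat R) natrD.
exists b; first by move: lb; clear; lia.
have small_b : 2^-1 ^+ b / (1 - r) <= delta ^+ 2 / 8.
  rewrite ler_pdivrMr // mulrAC; apply: hb0; move: lb; clear; lia.
move=> theta.
(* The growth in [n] cancels: [P ^+ t = n ^+ t.-1], and [n / (2 t) <= n %/ t]. *)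
have theta_le : theta <= delta ^+ 2 / 16.
  have m0 : (0 < n %/ t)%N by rewrite divn_gt0 //; move: nt; clear; lia.
  rewrite /theta ler_pdivrMr ?exprn_gt0 ?ltr0n //.
  have h1 : (4 * kappa.+1 * b)%:R <= delta ^+ 2 / 16 * (P / (2 * t%:R)).
    rewrite !natrM; apply: (@le_trans _ _ (4 * kappa.+1%:R * (g * P))).
      by rewrite ler_pM2l ?mulr_gt0.
    rewrite le_eqVlt; apply/orP; left; apply/eqP; rewrite /g; field.
    by rewrite !gt_eqF.
  have q1 : 0 <= delta ^+ 2 / 16 by rewrite divr_ge0 // ltW.
  have t2 : 0 <= 2 * t%:R :> R by rewrite mulr_ge0.
  have q2 : 0 <= P / (2 * t%:R) by rewrite divr_ge0.
  apply: (@le_trans _ _ ((delta ^+ 2 / 16 * (P / (2 * t%:R))) ^+ t)).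
    by apply: lerXn2r; rewrite ?nnegrE //; exact: mulr_ge0.
  rewrite exprMn; apply: ler_pM.
  - by rewrite exprn_ge0.
  - by rewrite exprn_ge0.
  - rewrite -[in leLHS](prednK t0) exprS -[leRHS]mulr1 ler_pM2l ?divr_gt0 //.
    by rewrite exprn_ile1 // ler_pdivrMr // mul1r (le_trans d21) // ler1n.
  have e2t : (2 * t%:R) ^+ t = 2 * t%:R * (2 * t%:R) ^+ t.-1 :> R.
    by rewrite -exprS prednK.
  rewrite expr_div_n powR_root_expr // e2t invfM mulrCA -expr_div_n.
  apply: (@le_trans _ _ (1 * (n%:R / (2 * t%:R)) ^+ t.-1)).
    apply: ler_wpM2r; first by rewrite exprn_ge0 // divr_ge0.
    by rewrite invf_le1 ?mulr_gt0 // -natrM ler1n; move: t0; clear; lia.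
  rewrite mul1r lerXn2r ?nnegrE ?divr_ge0 //.
  rewrite ler_pdivrMr ?mulr_gt0 // -!natrM ler_nat.
  have := divn_eq n t; have := ltn_pmod n t0; move: m0; clear; nia.
have fin (a u d : R) : a <= d / 16 -> u <= d / 8 -> d <= 1 ->
    a <= 2^-1 /\ 4 * (2 * a + u) <= d.
  by clear; split; lra.
exact: fin.
Qed.

(** The slack [r ^+ 2 - t * alpha], multiplied by [n], eventually exceeds the bounded loss from
    rounding in [n %/ t]. *)
Lemma ler_edges (R : archiRealFieldType) (alpha r : R) (t : nat) :
  0 <= alpha -> (0 < t)%N -> t%:R * alpha < r ^+ 2 ->
  exists n0 : nat, forall n m : nat, (n0 <= n)%N -> m%:R <= alpha * n%:R ->
    m%:R <= r ^+ 2 * (n %/ t)%:R.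
Proof.
move=> a0 t0 ht; have tR : 0 < t%:R :> R by rewrite ltr0n.
set rho := r ^+ 2 in ht *.
exists (Num.truncn (rho * t%:R / (rho - t%:R * alpha))).+1 => n m hn hm.
have h : rho * t%:R <= n%:R * (rho - t%:R * alpha).
  rewrite -ler_pdivrMr ?subr_gt0 //; apply: ltW.
  by apply: lt_le_trans (truncnS_gt _) _; rewrite ler_nat.
have nt : n%:R <= (n %/ t)%:R * t%:R + t%:R :> R.
  by rewrite -natrM -natrD ler_nat {1}(divn_eq n t) leq_add2l ltnW // ltn_pmod.
apply: (le_trans hm); rewrite -(ler_pM2r tR).
have rho0 : 0 <= rho by exact: sqr_ge0.
have := ler_wpM2l rho0 nt; move: h.
rewrite mulrBr mulrDr.
have -> : alpha * n%:R * t%:R = n%:R * (t%:R * alpha) by ring.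
have -> : rho * (n %/ t)%:R * t%:R = rho * ((n %/ t)%:R * t%:R) by ring.
rewrite (mulrC n%:R rho).
move: (rho * t%:R) (rho * n%:R) (n%:R * _) (rho * _) => x y z w; clear; lra.
Qed.

(** * Assembly of the space bound from the spectral gap and the protocol bound *)

Theorem theorem3 (R : realType) :
  exists c1 c2 : R, 0 < c1 /\
  forall alpha : R, 0 < alpha -> alpha < 2^-1 ->
  exists (c : R) (K : nat) (C : R -> R),
    [/\ c1 <= c, c <= c2, 0 < 1 + c / ln alpha &
        forall p : R, 2^-1 < p -> p <= 1 -> 0 < C p] /\
  forall f : R -> R, strictly_monotone_nneg f -> f 0 = 0 ->
  exists eps : R, 0 < eps /\
  forall p : R, 2^-1 < p -> p <= 1 ->
  forall d : nat, (2 <= d)%N ->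
  exists n0 : nat, forall n : nat, (n0 <= n)%N ->
  forall k : nat, (0 < k)%N -> k%:R <= alpha * n%:R ->
    let Q := fun A : 'M[R]_n => top_spectral_sum f k A in
    let b := C p * n%:R `^ (1 + c / ln alpha) in
    requires_space (fun s : seq (update R n) => poly_bounded d s) Q eps p b /\
    requires_space
      (fun s : seq (update R n) =>
         poly_bounded d s /\ (nnz (stream_matrix s) <= K * n)%N)
      Q eps p b.
Proof.
exists (ln 2 / 2), 2; split; first by rewrite divr_gt0 // ln_gt0 // ltr1n.
move=> alpha a0 a2; have [t t1 [ta1 ta2]] := exists_edge_size a0 a2.
have [c1c cc2 c_pos c_le] := exponent_bounds a0 a2 t1 ta2.
set c := Num.max _ _ in c1c cc2 c_pos c_le.
(* The mean of 1 and [t * alpha]: below 1, with [r ^+ 2 > t * alpha] by AM-GM. *)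
pose r := (1 + t%:R * alpha) / 2.
have ta0 : 0 <= t%:R * alpha by rewrite mulr_ge0 // ltW.
have r0 : 0 < r by rewrite /r; lra.
have r1 : r < 1 by rewrite /r; lra.
have r2 : t%:R * alpha < r ^+ 2.
  rewrite -subr_gt0 (_ : _ - _ = ((1 - t%:R * alpha) / 2) ^+ 2); last by rewrite /r; field.
  by rewrite exprn_gt0 // divr_gt0 // subr_gt0.
have [kappa k0 rk] := exists_small_expr (ltW r0) r1 (ltac:(lra) : 0 < 4^-1 :> R).
have tR : 0 < t%:R :> R by rewrite ltr0n ltnW.
(* Half of [2 * p - 1] goes to the hypermatching bound and a quarter, through [s] below, to the
   sparse messages; the total advantage then stays below the required [2 * p - 1]. *)
pose delta (p : R) := (2 * p - 1) / 2.
pose C (p : R) := delta p ^+ 2 / (512 * t%:R * kappa.+1%:R).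
(* [K = 2] counts at most [n] diagonal entries and at most [n] entries from the cycles. *)
exists c, 2%N, C; split.
  split=> // p p2 _; apply: divr_gt0; last by rewrite !mulr_gt0.
  by rewrite exprn_gt0 // /delta; lra.
move=> f f_mono f0.
case: t t1 @C @r ta1 ta2 c c1c cc2 c_pos c_le ta0 r0 r1 r2 rk tR => // t t1 C r
  ta1 ta2 c c1c cc2 c_pos c_le ta0 r0 r1 r2 rk tR.
pose tau : R := Num.sqrt (4 - (3 * t.+1%:R ^+ 2)^-1).
have tau2 : tau < 2.
  have -> : 2 = Num.sqrt 4 :> R.
    by rewrite (_ : 4 = 2 ^+ 2) ?sqrtr_sqr ?ger0_norm // -natrX.
  by rewrite ltr_sqrt // gtrBl invr_gt0 mulr_gt0 // exprn_gt0.
have [eps eps0 sep] := exists_separating_eps (normr_ge0 (f tau))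
  (ler_norm_monotone f_mono f0 (sqrtr_ge0 _) tau2).
exists eps; split=> // p p2 p1 d d2.
have dp0 : 0 < delta p by rewrite /delta; lra.
have dp1 : delta p <= 1 by rewrite /delta; lra.
have [s _ hs] := @exists_small_expr R 2^-1 ((2 * p - 1) / 4)
  ltac:(lra) ltac:(lra) ltac:(lra).
have [n1 hn1] := @exists_log_density R t.+1 kappa r (delta p) _ s t1 r0 r1 dp0 dp1 c_le.
have [n2 hn2] := ler_edges (ltW a0) (ltn0Sn t) r2.
exists (maxn (maxn n1 n2) 2) => n; rewrite !geq_max => /andP[/andP[nn1 nn2] n_gt1].
move=> k kpos hk Q b.
pose m := Num.truncn (alpha * n%:R).
have an0 : 0 <= alpha * n%:R by rewrite mulr_ge0 // ltW.
have m_le : m%:R <= alpha * n%:R by rewrite truncn_le.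
have km : (k <= m)%N by rewrite truncn_ge_nat.
have mt : (m * t.+1 <= n)%N.
  rewrite -(ler_nat R) natrM; apply: (@le_trans _ _ (alpha * n%:R * t.+1%:R)).
    by rewrite ler_pM2r.
  by rewrite mulrAC (mulrC alpha) -[leRHS]mul1r ler_wpM2r // ltW.
have [slot slot_inj] := exists_slot mt.
have e_inj (s0 : {perm 'I_n}) : injective (s0 \o slot).
  exact: inj_comp perm_inj slot_inj.
(* Both claims follow at once, since the argument runs for any promise satisfied by all gadget
   streams. *)
suff H adm : (forall (s0 : {perm 'I_n}) x w, adm (gadget_stream R (s0 \o slot) x w)) ->
    requires_space adm Q eps p b.
  split; apply: H => s0 x w; first exact: poly_bounded_gadget.
  split; first exact: poly_bounded_gadget.
  by rewrite gadget_streamE nnz_gadget.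
move=> adm_ok alg alg_ok; rewrite leNgt; apply/negP => few.
have [B hB [theta2 small]] := hn1 n (bits alg) nn1 few.
have even (s0 : {perm 'I_n}) x :
    Q (gadget R (s0 \o slot) x (edge_parity slot s0 x)) = k%:R * f 2.
  by apply: top_spectral_sum_even => // j; rewrite ffunE.
have odd (s0 : {perm 'I_n}) x y :
    approximates eps y (Q (gadget R (s0 \o slot) x (negv (edge_parity slot s0 x)))) ->
    ~ approximates eps y (k%:R * f 2).
  apply: sep kpos _ _; first by rewrite normrM ger0_norm.
  by apply: top_spectral_sum_odd => // j; rewrite !ffunE negbK.
have := streaming_advantage alg_ok adm_ok even odd
  (fun enc D => hypermatching_advantage_le enc D slot_inj (ltn0Sn t) dp0 r0 r1
     (hn2 n m nn2 m_le) k0 (rk kappa (leqnn _)) theta2 small).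
apply/negP; rewrite -ltNge card_tuple card_bool.
(* The log-density [B] exceeds the number of stored bits by at least [s], so this ratio is at most
   [2 ^ -s]. *)
have : (2 ^ bits alg)%:R / (2 ^ B)%:R <= (2 * p - 1) / 4.
  apply: le_trans (hs s (leqnn s)).
  rewrite ler_pdivrMr ?ltr0n ?expn_gt0 // exprVn mulrC ler_pdivlMr ?exprn_gt0 //.
  by rewrite -natrX -natrM ler_nat -expnD leq_exp2l.
rewrite /delta; lra.
Qed.
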